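(* Let $p$ be an odd prime. If $0\leq k\leq p-2$ and $-1\leq r\leq p-3-k$, then $$\dfrac{V_{r+(k+1)(p+1)}}{D(V_{r+2+k(p+1)})}\otimes V_{p-1}\simeq \mathrm{ind}_{T(\mathbb{F}_p)}^{G(\mathbb{F}_p)}\,\omega_2^{r+2+k(p+1)}$$ as representations of $G(\mathbb{F}_p)=\mathrm{GL}_2(\mathbb{F}_p)$ over $\mathbb{F}_{p^2}$.
   Context: For $n\ge 0$, $V_n$ is the $n$-th symmetric power of the standard representation of $G(\mathbb{F}_p)$, identified with homogeneous polynomials $P(X,Y)$ of degree $n$ over $\mathbb{F}_p$, with action $\begin{pmatrix} a & b\\ c & d\end{pmatrix}\cdot P(X,Y)=P(aX+cY,bX+dY)$; scalars are extended to $\mathbb{F}_{p^2}$ on the left-hand side. $D=X^p\frac{\partial}{\partial X}+Y^p\frac{\partial}{\partial Y}$, a $G(\mathbb{F}_p)$-linear map $V_n\to V_{n+p-1}$. Fix $\alpha\in\mathbb{F}_{p^2}\setminus\mathbb{F}_p$ with $\alpha^2\in\mathbb{F}_p$. $T(\mathbb{F}_p)\subset G(\mathbb{F}_p)$ is the image of the embedding $i:\mathbb{F}_{p^2}^\times\hookrightarrow G(\mathbb{F}_p)$, $u+v\alpha\mapsto\begin{pmatrix} u & v\alpha^2\\ v & u\end{pmatrix}$, and $\omega_2:T(\mathbb{F}_p)\to\mathbb{F}_{p^2}^\times$ is the inverse of $i$. $\mathrm{ind}_{T(\mathbb{F}_p)}^{G(\mathbb{F}_p)}\chi$ is the space of functions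 $f:G(\mathbb{F}_p)\to\mathbb{F}_{p^2}$ with $f(tg)=\chi(t)f(g)$ for $t\in T(\mathbb{F}_p)$, with $G(\mathbb{F}_p)$ acting by right translation. *)

(* Defs.v *)
From HB Require Import structures.
From mathcomp Require Import all_boot all_order all_algebra all_fingroup.
From mathcomp Require Import all_solvable all_field all_character.
From mathcomp Require Import mpoly zify ring.

Set Implicit Arguments.
Unset Strict Implicit.
Unset Printing Implicit Defensive.

Import Order.TTheory GRing.Theory Num.Theory.
Local Open Scope ring_scope.

(* Convention.  The vectors of a MathComp [mx_representation] are rows, and   *)
(* the group acts on them from the right by [v *m rG g].  A left              *)
(* representation is encoded by the row matrices of the right action          *)
(* [v . g := g^-1 v].  This changes neither the subspaces and quotients, nor  *)
(* the tensor products, nor the isomorphisms ([mx_rsim]).                     *)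

Section BinaryForms.

Variable R : comNzRingType.
Implicit Types (P Q : {mpoly R[2]}) (A B : 'M[R]_2).

Definition varX : {mpoly R[2]} := 'X_0.
Definition varY : {mpoly R[2]} := 'X_1.

Definition subst_form A P : {mpoly R[2]} :=
  P \mPo [tuple A 0 0 *: varX + A 1 0 *: varY; A 0 1 *: varX + A 1 1 *: varY].

(* The exponent of X^i Y^(n - i): the monomials of degree n are the           *)
(* [mon n i] with i <= n.                                                     *)
Definition mon (n i : nat) : 'X_{1..2} := [multinom [tuple i; (n - i)%N]].

Definition form_of_row n (v : 'rV[R]_n.+1) : {mpoly R[2]} :=
  \sum_(i < n.+1) v 0 i *: 'X_[mon n i].

Definition row_of_form n P : 'rV[R]_n.+1 := \row_i P@_(mon n i).

Definition D_form (p : nat) P : {mpoly R[2]} :=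
  varX ^+ p * P^`M(0) + varY ^+ p * P^`M(1).

Lemma mon_inj n : injective (fun i : 'I_n.+1 => mon n i).
Proof.
move=> i j /(congr1 (fun m : 'X_{1..2} => m 0)).
by rewrite !multinomE !(tnth_nth 0%N) /= => /val_inj.
Qed.

Lemma mdeg_mon n (i : 'I_n.+1) : mdeg (mon n i) = n.
Proof.
rewrite mdegE !big_ord_recl big_ord0 !multinomE !(tnth_nth 0%N) /= addn0.
by rewrite subnKC // -ltnS.
Qed.

Lemma monP n (m : 'X_{1..2}) : mdeg m = n -> exists i : 'I_n.+1, m = mon n i.
Proof.
rewrite mdegE !big_ord_recl big_ord0 addn0 => dm.
have lt0 : (m ord0 < n.+1)%N by rewrite ltnS -dm leq_addr.
exists (Ordinal lt0); apply/mnmP=> i; rewrite multinomE (tnth_nth 0%N) /=.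
case: i => [[|[|i]] //= lti]; first by congr (m _); apply: val_inj.
by rewrite -dm addKn; congr (m _); apply: val_inj.
Qed.

Lemma form_of_row_homog n (v : 'rV[R]_n.+1) : form_of_row v \is n.-homog.
Proof.
by apply: rpred_sum => i _; rewrite rpredZ // dhomogX /= mdeg_mon.
Qed.

Lemma form_of_rowK n : cancel (@form_of_row n) (@row_of_form n).
Proof.
move=> v; apply/rowP=> i; rewrite mxE raddf_sum (bigD1 i) //= big1 => [|j ji].
  by rewrite mcoeffZ mcoeffX eqxx mulr1 addr0.
rewrite mcoeffZ mcoeffX; case: eqP => [/mon_inj ji'|_]; last by rewrite mulr0.
by rewrite ji' eqxx in ji.
Qed.

Lemma row_of_formK n P : P \is n.-homog -> form_of_row (row_of_form n P) = P.
Proof.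
move=> Ph; apply/mpolyP=> m.
have Qh := form_of_row_homog (row_of_form n P).
have [/monP[i ->]|dm] := eqVneq (mdeg m) n.
  by have /rowP/(_ i) := form_of_rowK (row_of_form n P); rewrite !mxE.
by rewrite !(dhomog_nemf_coeff _ dm).
Qed.

HB.instance Definition _ A :=
  GRing.LRMorphism.copy (subst_form A)
    (comp_mpoly [tuple A 0 0 *: varX + A 1 0 *: varY;
                       A 0 1 *: varX + A 1 1 *: varY]).

Lemma subst_formX A i : subst_form A 'X_i = A 0 i *: varX + A 1 i *: varY.
Proof.
rewrite /subst_form comp_mpolyXU; case: i => [[|[|i]] lti] //=.
  by rewrite (_ : Ordinal lti = 0) //; apply: val_inj.
by rewrite (_ : Ordinal lti = 1) //; apply: val_inj.
Qed.


Lemma subst_form_homog n A P : P \is n.-homog -> subst_form A P \is n.-homog.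
Proof.
move=> /dhomogP Ph; rewrite [P]mpolyE raddf_sum /= big_seq.
apply: rpred_sum => m /Ph dm; rewrite linearZ rpredZ //.
rewrite mpolyXE_id rmorph_prod !big_ord_recl big_ord0 mulr1 /= !rmorphXn /=.
move: dm; rewrite /= mdegE !big_ord_recl big_ord0 addn0 => <-.
apply: dhomogM; rewrite -[X in X.-homog]mul1n; apply: dhomogMn;
  by rewrite subst_formX rpredD // rpredZ // dhomogX /= mdeg1.
Qed.

Lemma mpoly_monomial_ind (K : {mpoly R[2]} -> Prop) :
    K 1 -> (forall P Q, K P -> K Q -> K (P + Q)) ->
    (forall c P, K P -> K (c *: P)) -> (forall i P, K P -> K ('X_i * P)) ->
  forall P, K P.
Proof.
move=> K1 KD KZ KM P.
have K0: K 0 by rewrite -(scale0r 1); apply: KZ.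
rewrite [P]mpolyE; elim: (msupp P) => [|m s IHs]; first by rewrite big_nil.
rewrite big_cons; apply: KD => //; apply: KZ.
rewrite mpolyXE_id !big_ord_recl big_ord0 mulr1.
elim: (m ord0) => [|k IHk]; last by rewrite exprS -mulrA; apply: KM.
rewrite mul1r; elim: (m _) => [|k IHk] //.
by rewrite exprS; apply: KM.
Qed.

Lemma subst_formM A B P :
  subst_form (A *m B) P = subst_form A (subst_form B P).
Proof.
elim/mpoly_monomial_ind: P => [|P Q IHP IHQ|c P IHP|i P IHP].
- by rewrite !rmorph1.
- by rewrite !rmorphD /= IHP IHQ.
- by rewrite !linearZ /= IHP.
rewrite !rmorphM /= IHP; congr (_ * _).
rewrite !subst_formX linearD !linearZ /= /varX /varY !subst_formX.
rewrite !mxE !big_ord_recl !big_ord0 !addr0 /=.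
have -> : lift ord0 ord0 = 1 :> 'I_2 by apply: val_inj.
have -> : ord0 = 0 :> 'I_2 by apply: val_inj.
rewrite !scalerDl !scalerDr !scalerA addrACA.
by rewrite -!(mulrC (B _ _)).
Qed.

Lemma subst_form1 P : subst_form 1%:M P = P.
Proof.
elim/mpoly_monomial_ind: P => [|P Q IHP IHQ|c P IHP|i P IHP].
- by rewrite !rmorph1.
- by rewrite !rmorphD /= IHP IHQ.
- by rewrite !linearZ /= IHP.
rewrite !rmorphM /= IHP; congr (_ * _); rewrite subst_formX !mxE.
case: i => [[|[|i]] lti] //=; rewrite !(scale0r, scale1r) ?addr0 ?add0r.
  by congr 'X_[U_(_)]; apply: val_inj.
by congr 'X_[U_(_)]; apply: val_inj.
Qed.

Lemma D_form_is_linear p : linear (D_form p).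
Proof.
move=> c P Q; rewrite /D_form !mderivD !mderivZ !mulrDr -!scalerAr.
by rewrite scalerDr addrACA.
Qed.
HB.instance Definition _ p :=
  GRing.isLinear.Build R {mpoly R[2]} {mpoly R[2]} _ (D_form p)
    (D_form_is_linear p).

Lemma D_formM p P Q : D_form p (P * Q) = D_form p P * Q + P * D_form p Q.
Proof.
by rewrite /D_form !mderivM; ring.
Qed.

Lemma D_formXi p i : D_form p 'X_i = 'X_i ^+ p.
Proof.
have subU (j : 'I_2) : (U_(j) - U_(j) = 0 :> 'X_{1..2})%MM.
  by apply/mnmP => l; rewrite !mnmE subnn.
rewrite /D_form !mderivX !mnm1E.
have [->|->] : i = 0 \/ i = 1.
  by case: i => [[|[|i]] lti] //; [left | right]; apply: val_inj.
  by rewrite !eqxx /= scale0r mulr0 addr0 subU scale1r mpolyX0 mulr1.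
by rewrite !eqxx /= scale0r mulr0 add0r subU scale1r mpolyX0 mulr1.
Qed.

Lemma D_form1 p : D_form p 1 = 0.
Proof. by rewrite /D_form -mpolyC1 !mderivC !mulr0 addr0. Qed.

Lemma D_form_homog p n P :
  (0 < p)%N -> P \is n.-homog -> D_form p P \is (n + p.-1).-homog.
Proof.
move=> p0 /dhomogP Ph; rewrite [P]mpolyE raddf_sum /= big_seq.
apply: rpred_sum => m /Ph dm; rewrite linearZ rpredZ //.
have mono i : 'X_i ^+ p * ('X_[m])^`M(i) \is [in R[2], (n + p.-1).-homog].
  rewrite mderivX -scalerAr.
  have [->|mi0] := eqVneq (m i) 0%N; first by rewrite scale0r rpred0.
  rewrite rpredZ // mpolyXn -mpolyXD dhomogX /= mdegD mdegMn mdeg1 mul1n.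
  have : mdeg (m - U_(i) + U_(i))%MM = n by rewrite submK // lep1mP.
  rewrite mdegD mdeg1 => <-; apply/eqP.
  by move: p0; lia.
by rewrite rpredD // mono.
Qed.

Lemma D_form_subst p A P :
    p \in [pchar R] -> (forall i j, A i j ^+ p = A i j) ->
  D_form p (subst_form A P) = subst_form A (D_form p P).
Proof.
move=> chR Ap; have chP : p \in [pchar {mpoly R[2]}].
  have /andP[pr_p /eqP p0] := chR.
  by rewrite inE pr_p -mpolyC_nat p0 mpolyC0 eqxx.
elim/mpoly_monomial_ind: P => [|P Q IHP IHQ|c P IHP|i P IHP].
- by rewrite rmorph1 !D_form1 raddf0.
- by rewrite raddfD [LHS]raddfD /= IHP IHQ -raddfD -raddfD.
- by rewrite linearZ [LHS]linearZ /= IHP -linearZ -linearZ.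
rewrite rmorphM /= !D_formM [RHS]raddfD /= 2![in RHS]rmorphM /= IHP.
congr (_ * _ + _).
rewrite D_formXi rmorphXn /= subst_formX raddfD /=.
rewrite [D_form p (A 0 i *: _)]linearZ [D_form p (A 1 i *: _)]linearZ /=.
rewrite !D_formXi -!(pFrobenius_autE chP) rmorphD /= !pFrobenius_autE.
by rewrite !exprZn !Ap.
Qed.

Definition sym_mx n A : 'M[R]_n.+1 :=
  \matrix_(i < n.+1) row_of_form n (subst_form A 'X_[mon n i]).

Definition D_mx p n m : 'M[R]_(n.+1, m.+1) :=
  \matrix_(i < n.+1) row_of_form m (D_form p 'X_[mon n i]).

Lemma mul_sym_mx n A (v : 'rV_n.+1) :
  v *m sym_mx n A = row_of_form n (subst_form A (form_of_row v)).
Proof.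
apply/rowP=> j; rewrite !mxE /form_of_row.
rewrite (raddf_sum (subst_form A)) raddf_sum /=.
by apply: eq_bigr => i _; rewrite linearZ /= mcoeffZ !mxE.
Qed.

Lemma mul_D_mx p n m (v : 'rV_n.+1) :
  v *m D_mx p n m = row_of_form m (D_form p (form_of_row v)).
Proof.
apply/rowP=> j; rewrite !mxE /form_of_row raddf_sum raddf_sum /=.
by apply: eq_bigr => i _; rewrite linearZ /= mcoeffZ !mxE.
Qed.

Lemma sym_mx1 n : sym_mx n 1%:M = 1%:M.
Proof.
apply/row_matrixP => i.
by rewrite !rowE mul_sym_mx subst_form1 form_of_rowK mulmx1.
Qed.

Lemma sym_mxM n A B : sym_mx n (A *m B) = sym_mx n B *m sym_mx n A.
Proof.
apply/row_matrixP => i; rewrite !rowE mulmxA !mul_sym_mx subst_formM.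
by rewrite row_of_formK ?subst_form_homog ?form_of_row_homog.
Qed.

End BinaryForms.

Section GL2Representations.

Variable p : nat.

Local Notation GL2 := [set: {'GL_2['F_p]}]%G.

Lemma sym_mx_repr n :
  mx_repr GL2 (fun g : {'GL_2['F_p]} => sym_mx n (GLval g^-1%g)).
Proof.
split=> [|g h _ _]; first by rewrite invg1 sym_mx1.
by rewrite invMg GL_MxE sym_mxM.
Qed.

(* V_n: by [mul_sym_mx], the row of P is sent by g to the row of g^-1 P. *)
Definition sym_repr n : mx_representation 'F_p GL2 n.+1 :=
  MxRepresentation (sym_mx_repr n).

Lemma D_mx_module n m (pr_p : prime p) (e : m = (n + p.-1)%N) :
  mxmodule (sym_repr m) <<D_mx 'F_p p n m>>%MS.
Proof.
rewrite (eqmx_module _ (genmxE _)).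
apply/mxmoduleP => g _.
have -> : sym_repr m g = sym_mx m (GLval g^-1%g) by [].
set A := GLval _.
apply/row_subP => i; rewrite rowE mulmxA mul_D_mx mul_sym_mx.
set P := form_of_row (delta_mx _ _).
have Ph : P \is n.-homog by apply: form_of_row_homog.
rewrite row_of_formK; last by rewrite e D_form_homog ?prime_gt0.
rewrite -D_form_subst ?pchar_Fp //; last first.
  by move=> j l; rewrite -[X in _ ^+ X](card_Fp pr_p) expf_card.
by rewrite -(row_of_formK (subst_form_homog A Ph)) -mul_D_mx submxMl.
Qed.

(* V_m / D(V_n): the row space of [D_mx] is D(V_n), by [mul_D_mx]. *)
Definition sym_mod_D n m (pr_p : prime p) (e : m = (n + p.-1)%N) :=
  factmod_repr (D_mx_module pr_p e).

End GL2Representations.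

Section Induction.

Variables (F : fieldType) (gT : finGroupType) (T : {set gT}) (chi : gT -> F).

Local Notation G := [set: gT]%G.
Local Notation ix := (gring_index G).

(* A function f : gT -> F is encoded by the row with entry f x at [ix x];     *)
(* under the above convention, [regular_repr F G] is then the action of G on  *)
(* these functions by right translation.                                      *)
Definition ind_mx : 'M[F]_(gcard G) :=
  (\bigcap_(t in T) \bigcap_(x : gT)
    kermx (delta_mx (ix (t * x)%g) 0
           - chi t *: delta_mx (ix x) (0 : 'I_1)))%MS.

Lemma ind_mxP (v : 'rV_(gcard G)) :
  reflect (forall t x, t \in T -> v 0 (ix (t * x)%g) = chi t * v 0 (ix x))
          (v <= ind_mx)%MS.
Proof.
apply: (iffP sub_bigcapmxP) => [vP t x Tt | vP t Tt].
  have /sub_bigcapmxP/(_ x isT)/sub_kermxP := vP t Tt.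
  rewrite mulmxBr -scalemxAr -!colE => /eqP.
  rewrite subr_eq0 => /eqP/colP/(_ 0).
  by rewrite !mxE.
apply/sub_bigcapmxP => x _; apply/sub_kermxP/eqP.
by rewrite mulmxBr -scalemxAr -!colE subr_eq0; apply/eqP/colP=> j;
  rewrite !mxE ord1 vP.
Qed.

Lemma regular_actE (v : 'rV_(gcard G)) g x :
  (v *m regular_repr F G g) 0 (ix x) = v 0 (ix (x * g^-1)%g).
Proof.
rewrite mxE (bigD1 (ix (x * g^-1)%g)) //= big1 => [|j jx]; rewrite !mxE.
  by rewrite gring_indexK ?inE // mulgKV !eqxx mulr1 addr0.
rewrite eqxx /=; case: eqP => [xj|_]; last by rewrite mulr0.
have := congr1 enum_val xj.
rewrite !gring_indexK ?inE // => xE; case/eqP: jx.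
by rewrite xE mulgK gring_valK.
Qed.

Lemma ind_mx_module : mxmodule (regular_repr F G) ind_mx.
Proof.
apply/mxmoduleP => g _; apply/row_subP => i; rewrite rowE mulmxA -rowE.
apply/ind_mxP => t x Tt; rewrite !regular_actE -mulgA.
by move/ind_mxP: (row_sub i ind_mx) => ->.
Qed.

Definition ind_repr := submod_repr ind_mx_module.

End Induction.

Section NonSplitTorus.

Variables (p : nat) (L : fieldExtType 'F_p) (alpha : L) (d : 'F_p).

Definition torus_mx (u v : 'F_p) : 'M['F_p]_2 :=
  \matrix_(i, j) (if i == j then u else if i == 0 then v * d else v).

(* When d%:A = alpha ^+ 2, this is the image of                               *)
(*   i : u%:A + v%:A * alpha |-> torus_mx u v.                                *)
Definition torus : {set {'GL_2['F_p]}} :=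
  [set g : {'GL_2['F_p]} |
    [exists u : 'F_p, exists v : 'F_p, GLval g == torus_mx u v]].

(* The inverse of i: the first column of torus_mx u v is (u, v). *)
Definition omega2 (g : {'GL_2['F_p]}) : L :=
  (GLval g 0 0)%:A + (GLval g 1 0)%:A * alpha.

Hypotheses (alphaNF : alpha \notin 1%VS) (alpha2 : alpha ^+ 2 = d%:A).

Lemma torus_coord0 u v : u%:A + v%:A * alpha = 0 :> L -> u = 0 /\ v = 0.
Proof.
have [-> | v0] := eqVneq v 0.
  by rewrite scale0r mul0r addr0 => /eqP;
    rewrite scaler_eq0 oner_eq0 orbF => /eqP.
move=> uva; case/negP: alphaNF.
have -> : alpha = (- (u / v))%:A.
  apply: (mulfI (_ : v%:A != 0)); first by rewrite scaler_eq0 oner_eq0 orbF.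
  apply/eqP; rewrite -subr_eq0 -scalerAl mul1r -scalerAl mul1r scalerA.
  by rewrite mulrN mulrCA divff // mulr1 scaleNr opprK addrC -uva;
    rewrite -scalerAl mul1r.
by rewrite memvZ ?mem1v.
Qed.

Lemma torus_mxP g : g \in torus ->
  GLval g = torus_mx (GLval g 0 0) (GLval g 1 0).
Proof.
by rewrite inE => /existsP[u /existsP[v /eqP ->]]; rewrite !mxE.
Qed.

Lemma omega2_inj : {in torus &, injective omega2}.
Proof.
move=> g h Tg Th /eqP; rewrite -subr_eq0 /omega2 opprD addrACA -mulrBl.
rewrite -!scalerBl => /eqP/torus_coord0[/subr0_eq e0 /subr0_eq e1].
by apply: val_inj; rewrite /= -!/(GLval _) torus_mxP // e0 e1 -torus_mxP.
Qed.

Lemma omega2M : {in torus &, {morph omega2 : g h / (g * h)%g >-> g * h}}.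
Proof.
move=> g h /torus_mxP Eg /torus_mxP Eh; rewrite /omega2 GL_MxE Eg Eh.
move: (GLval g 0 0) (GLval g 1 0) (GLval h 0 0) (GLval h 1 0) => u v u' v'.
rewrite !mxE !big_ord_recl !big_ord0 !mxE /= !addr0.
have AM (x y : 'F_p) : (x * y)%:A = x%:A * y%:A :> L.
  by rewrite -scalerAl mul1r scalerA.
by rewrite !scalerDl !AM -alpha2; ring.
Qed.

Lemma omega2_surj (z : L) : \dim {:L} = 2%N -> z != 0 ->
  exists2 g, g \in torus & omega2 g = z.
Proof.
move=> dimL z0.
have [u [v zE]] : exists u v : 'F_p, z = u%:A + v%:A * alpha.
  have dim2 : \dim (1 + <[alpha]>)%VS = 2%N.
    rewrite dimv_disjoint_sum ?dimv1 ?dim_vline.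
      by case: eqP alphaNF => // ->; rewrite mem0v.
    apply/eqP; rewrite -subv0; apply/subvP => x; rewrite memv_cap memv0.
    case/andP=> /vlineP[a ->] /vlineP[b /eqP].
    rewrite -subr_eq0 -scaleNr -[alpha]mul1r scalerAl.
    by move/eqP/torus_coord0 => [-> _]; rewrite scale0r.
  have : z \in (1 + <[alpha]>)%VS.
    have /eqP -> : (1 + <[alpha]>)%VS == {:L}%VS; last exact: memvf.
    by rewrite eqEdim subvf dimL dim2.
  case/memv_addP=> _ /vlineP[u ->] [_ /vlineP[v ->] ->].
  by exists u, v; rewrite -scalerAl mul1r.
have uM : torus_mx u v \in unitmx.
  rewrite unitmxE unitfE; apply: contraNneq z0 => /eqP.
  rewrite (expand_det_row _ 0) !big_ord_recl big_ord0 /cofactor.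
  rewrite !det_mx11 !mxE /= addr0 expr0 mul1r.
  rewrite /bump /= addn0 expr1 mulN1r mulrN subr_eq0 => /eqP uv.
  have : (u%:A + (- v)%:A * alpha) * z = 0.
    have AM (x y : 'F_p) : (x * y)%:A = x%:A * y%:A :> L.
      by rewrite -scalerAl mul1r scalerA.
    have uvA : u%:A * u%:A = v%:A * alpha ^+ 2 * v%:A.
      by rewrite alpha2 -!AM uv.
    by rewrite zE scaleNr; ring: uvA.
  move/eqP; rewrite mulf_eq0 => /orP[/eqP/torus_coord0[u0 /eqP]|//].
  by rewrite oppr_eq0 => /eqP v0; rewrite zE u0 v0 !scale0r mul0r addr0.
exists (FinRing.Unit (uM : torus_mx u v \is a GRing.unit)).
  by rewrite inE; apply/existsP; exists u; apply/existsP; exists v.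
by rewrite zE /omega2 !mxE.
Qed.

End NonSplitTorus.

(* r is an integer because it may be -1; both degrees are nonnegative. *)
Lemma degreeE (p k : nat) (r : int) : prime p -> -1 <= r ->
  absz (r + (k%:Z + 1) * (p%:Z + 1))
    = (absz (r + 2 + k%:Z * (p%:Z + 1))%R + p.-1)%N.
Proof. by move=> /prime_gt0 p0 r1; nia. Qed.

(* Main.v *)
From HB Require Import structures.
Require Import Defs.
From mathcomp Require Import all_boot all_order all_algebra all_fingroup.
From mathcomp Require Import all_solvable all_field all_character.
From mathcomp Require Import mpoly zify ring.

Set Implicit Arguments.
Unset Strict Implicit.
Unset Printing Implicit Defensive.

Import Order.TTheory GRing.Theory Num.Theory.
Local Open Scope ring_scope.

(** Write s = r + 2, n = s + k (p + 1) and m = n + p - 1, so that 0 < s,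
    s + k < p, the left-hand side is built from W = V_m / D(V_n), and the
    exponent of omega_2 is n.

    Evaluate forms at the row vector zeta = (1, alpha) and at its conjugate
    zeta' = (1, - alpha).  The torus T multiplies zeta by tau = omega_2(t) and
    zeta' by tau^p, so the coefficient of beta^j in P(zeta + beta zeta') is a
    functional of V_m on which t acts by tau^(m + (p - 1) j).  By Frobenius
    reciprocity a functional lambda on V_m (x) V_(p-1) of weight tau^n that
    kills D(V_n) (x) V_(p-1) gives a G-map from W (x) V_(p-1) to the induced
    representation, v |-> (g |-> lambda (g v)).  It is enough to choose lambda
    such that this map is onto, because both sides have dimension p (p - 1).

    Dimensions. A form killed by D becomes, after Y := 1, a solution f of (X^p -
    X) f' = - n f. Such an f is divisible by a power of X^p - X whose degree
    exceeds n, so it is 0 ([euler_ode_eq0]); thus D is injective and dim W = p -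
    1 ([D_mx_free], [dim_sym_mod_D]). The mirabolic group of the matrices [1, a;
    0, b] is a complement of T in G ([torus_mirabolic_factor]), so an element of
    the induced representation is determined by its restriction to it, a
    function of (a, b); hence the bound of [rank_ind_le].

    Surjectivity.  The linear relations satisfied by these restrictions form a
    space stable under the mirabolic group, which acts on z = a + b alpha by
    affine maps.  Translations are unipotent and the maps z |-> c z are
    diagonalisable, so a nonzero space of relations contains some
    (a, b) |-> b^e ([affine_orbit_relation]).  Only p - 1 conditions remain: for
    each e, a tensor v such that the sum of b^e lambda (g v) over the mirabolic
    group is not 0.

    Choice of lambda. In the coordinate beta the operator D reads F |-> n beta^p
    F + (1 - beta^(p+1)) F' ([ev_D]). Two functionals on V_m kill its image. One
    is the coefficient of beta^(p-1) ([top_functional]); it factors through the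
    quotient V_(p-1-s) of W, up to a twist. The other is a combination of the
    coefficients of beta^(l (p+1)) ([hw_functional]), and is nonzero, for s > 1,
    on the subrepresentation V_(s-2) of W, up to a twist. The first is tensored
    with the coefficient of beta^0 on V_(p-1), the second with that of
    beta^(p-1), and lambda is a combination of the two tensors. On suitable
    monomials the sums above become power sums over F_p that reduce to one
    binomial coefficient ([sum_shift_exp2]), and for every e one of the two
    tensors gives a nonzero value ([mirabolic_moment_cases]). At most p - 1
    values of the mixing coefficient are bad, so one of the p elements of F_p
    works ([cyclic_functional]). *)

(** * Homogeneous forms and the operator D *)

Lemma mon_varE (R : comNzRingType) n i :
  'X_[mon n i] = 'X_0 ^+ i * 'X_1 ^+ (n - i) :> {mpoly R[2]}.
Proof.
rewrite mpolyXE_id !big_ord_recl big_ord0 mulr1 !multinomE !(tnth_nth 0%N) /=.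
have -> : lift ord0 ord0 = 1 :> 'I_2 by apply: val_inj.
by have -> : ord0 = 0 :> 'I_2 by apply: val_inj.
Qed.

Lemma homog_form_ind (R : comNzRingType) (K : nat -> {mpoly R[2]} -> Prop) :
    K 0%N 1 -> (forall n P Q, K n P -> K n Q -> K n (P + Q)) ->
    (forall n c P, K n P -> K n (c *: P)) ->
    (forall n i P, K n P -> K n.+1 ('X_i * P)) ->
  forall n P, P \is n.-homog -> K n P.
Proof.
move=> K1 KD KZ KM n P Ph; rewrite -(row_of_formK Ph) /form_of_row.
have Kmon (i : 'I_n.+1) : K n 'X_[mon n i].
  have KX a b : K (a + b)%N ('X_0 ^+ a * 'X_1 ^+ b).
    elim: a => [|a IHa].
      by rewrite mul1r; elim: b => [|b IHb] //; rewrite exprS; apply: KM.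
    by rewrite exprS -mulrA addSn; apply: KM.
  by have := KX i (n - i)%N; rewrite -mon_varE subnKC // -ltnS.
have K0 : K n 0.
  by rewrite -(scale0r ('X_[mon n (@ord0 n)] : {mpoly R[2]})); apply: KZ.
elim: (index_enum _) => [|i s IHs]; first by rewrite big_nil.
by rewrite big_cons; apply: KD => //; apply: KZ.
Qed.

(** Both sides are derivations in P along phi, except for the term in u, which
    counts the degree; so only the variables have to be checked.  This covers
    the two dehomogenisations used below. *)
Lemma D_form_transport (R : comNzRingType) (S : comNzRingType)
    (phi : {rmorphism {mpoly R[2]} -> {poly S}}) p (u w : {poly S}) :
    (forall c, (phi c%:MP)^`() = 0) ->
    (forall i, phi 'X_i ^+ p = u * phi 'X_i + w * (phi 'X_i)^`()) ->
  forall n P, P \is n.-homog ->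
    phi (D_form p P) = u * phi P *+ n + w * (phi P)^`().
Proof.
move=> phiC phiX; apply: homog_form_ind => [|n P Q IHP IHQ|n c P IHP|n i P IHP].
- by rewrite D_form1 !(rmorph0, rmorph1) derivC mulr0 addr0.
- have -> : D_form p (P + Q) = D_form p P + D_form p Q by rewrite raddfD.
  by rewrite (rmorphD phi (D_form p P)) (rmorphD phi P) derivD IHP IHQ; ring.
- rewrite -mul_mpolyC D_formM.
  rewrite (_ : D_form p c%:MP = 0) ?mul0r ?add0r; last first.
    by rewrite /D_form !mderivC !mulr0 addr0.
  rewrite !(rmorphM phi) /= IHP derivM phiC; ring.
- rewrite D_formM D_formXi (rmorphD phi (_ * _)) !(rmorphM phi) /= rmorphXn /=.
  rewrite IHP phiX derivM.
  by rewrite mulrSr; ring.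
Qed.

Lemma Fp_natr_eq0 p (pr_p : prime p) n : (n%:R == 0 :> 'F_p) = (p %| n)%N.
Proof. by rewrite (dvdn_pcharf (pchar_Fp pr_p)). Qed.

Lemma deriv_XpsubX p (pr_p : prime p) :
  ('X^p - 'X)^`() = -1 :> {poly 'F_p}.
Proof.
have p0 : p%:R = 0 :> 'F_p by apply/eqP; rewrite Fp_natr_eq0.
by rewrite derivB derivX derivXn -scaler_nat p0 scale0r sub0r.
Qed.

(** If f = (X^p - X)^j g then (X^p - X) g' = (j - n) g, because the derivative
    of X^p - X is -1.  So X^p - X divides g as long as j <> n mod p, and f is
    divisible by the power of exponent n mod p, whose degree is too large. *)
Lemma euler_ode_eq0 p (pr_p : prime p) n (f : {poly 'F_p}) :
    (n < p * (n %% p))%N -> (size f <= n.+1)%N ->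
  f *+ n + ('X^p - 'X) * f^`() = 0 -> f = 0.
Proof.
move=> ltn szf ode; set q : {poly 'F_p} := 'X^p - 'X in ode.
have szq : size q = p.+1.
  by rewrite size_polyDl ?size_polyXn // size_polyN size_polyX ltnS prime_gt1.
have q0 : q != 0 by rewrite -size_poly_eq0 szq.
have [g fE] : exists g, f = q ^+ (n %% p) * g.
  have := leqnn (n %% p); elim: {1 3}(n %% p)%N => [|j IHj] ltj.
    by exists f; rewrite mul1r.
  have [g fE] := IHj (ltnW ltj).
  have step : q * g^`() = g *+ j - g *+ n.
    apply: (mulfI (expf_neq0 j q0)); apply/eqP; rewrite -subr_eq0 -ode fE.
    have dq : (q ^+ j)^`() * q = - (q ^+ j *+ j).
      rewrite deriv_exp deriv_XpsubX // mulN1r mulNrn mulNr; congr (- _).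
      by case: (j) => [|i]; rewrite ?mulr0n ?mul0r // mulrnAl -exprSr.
    rewrite derivM.
    have -> : q ^+ j * g *+ n + q * ((q ^+ j)^`() * g + q ^+ j * g^`())
      = q ^+ j * g *+ n + ((q ^+ j)^`() * q * g + q ^+ j * (q * g^`())) by ring.
    by rewrite dq; apply/eqP; ring.
  have nj : (n - j)%:R != 0 :> 'F_p.
    rewrite Fp_natr_eq0 // {1}(divn_eq n p) -addnBA ?(ltnW ltj) //.
    rewrite dvdn_addr ?dvdn_mull // gtnNdvd ?subn_gt0 //.
    by rewrite (leq_ltn_trans (leq_subr _ _)) // ltn_mod prime_gt0.
  have jn : (j <= n)%N := leq_trans (ltnW ltj) (leq_mod n p).
  exists (- (n - j)%:R^-1 *: g^`()).
  rewrite fE exprSr -mulrA -scalerAr step -[in g *+ n](subnKC jn) mulrnDr.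
  rewrite opprD addNKr -scaler_nat scalerN.
  by rewrite scalerA mulNr mulVf // scaleN1r opprK.
apply/eqP; apply: contraLR szf => f0; rewrite -ltnNge.
have g0 : g != 0 by apply: contraNneq f0 => g0; rewrite fE g0 mulr0.
have := size_exp q (n %% p); rewrite szq /= => szqn.
have := expf_neq0 (n %% p) q0; rewrite -size_poly_gt0 => szqn0.
rewrite fE size_mul ?expf_neq0 //; move: g0; rewrite -size_poly_gt0.
by move: szqn szqn0 ltn; move: (p * _)%N (size (q ^+ _)) (size g) => w u v; lia.
Qed.

(** Setting Y = 1 in D P turns it into n f + (X^p - X) f' by the formula of
    Euler for homogeneous polynomials. *)
Lemma D_mx_free p (pr_p : prime p) n m :
  (n < p * (n %% p))%N -> m = (n + p.-1)%N -> row_free (D_mx 'F_p p n m).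
Proof.
move=> ltn mE; apply: inj_row_free => v; rewrite mul_D_mx => /= DP0.
have Ph := form_of_row_homog v; set P := form_of_row v in Ph DP0.
have {}DP0 : D_form p P = 0.
  rewrite -[LHS](@row_of_formK _ m) ?DP0 /form_of_row.
    by rewrite big1 // => i _; rewrite mxE scale0r.
  by rewrite mE D_form_homog ?prime_gt0.
pose h (i : 'I_2) : {poly 'F_p} := if i == 0 then 'X else 1.
pose phi : {rmorphism {mpoly 'F_p[2]} -> {poly 'F_p}} := mmap polyC h.
have phiX i : phi 'X_i = h i by rewrite /phi /= mmapX mmap1U.
have phiE : phi P = \poly_(i < n.+1) v 0 (inord i).
  rewrite poly_def /P /form_of_row rmorph_sum; apply: eq_bigr => i _.
  rewrite /phi /= mmapZ mul_polyC -/(phi _) mon_varE rmorphM !rmorphXn /=.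
  by rewrite !phiX /h /= expr1n mulr1 inord_val.
have : phi P = 0.
  apply: (@euler_ode_eq0 p pr_p n) => //.
    by rewrite phiE size_poly.
  have := @D_form_transport _ _ phi p 1 ('X^p - 'X) _ _ _ _ Ph.
  rewrite DP0 rmorph0 mul1r => -> //.
    by move=> c; rewrite /phi /= mmapC derivC.
  move=> i; rewrite phiX mul1r /h; case: ifP => _.
    by rewrite derivX mulr1 subrKC.
  by rewrite derivC mulr0 addr0 expr1n.
rewrite phiE => /polyP v0; apply/rowP=> i; have := v0 i.
by rewrite coef_poly ltn_ord inord_val coef0 mxE.
Qed.

(** * Evaluation at a conjugate pair of vectors *)

Section Evaluation.

Variables (R S : comNzRingType) (iota : {rmorphism R -> S}).
Implicit Types (A B : 'M[R]_2) (P Q : {mpoly R[2]}).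

(** The row vector (1, x) A. *)
Definition point (x : S) A (j : 'I_2) : S := iota (A 0 j) + iota (A 1 j) * x.

Lemma point_mul x A B j :
  point x (A *m B) j = point x A 0 * iota (B 0 j) + point x A 1 * iota (B 1 j).
Proof.
rewrite /point !mxE !big_ord_recl !big_ord0 !addr0 /=.
have -> : lift ord0 ord0 = 1 :> 'I_2 by apply: val_inj.
have -> : ord0 = 0 :> 'I_2 by apply: val_inj.
by rewrite !rmorphD !rmorphM /=; ring.
Qed.

Variable alpha : S.

(** The vector (1, alpha) A + beta (1, - alpha) A, with beta written 'X. *)
Definition line_form A (j : 'I_2) : {poly S} :=
  (point alpha A j)%:P + (point (- alpha) A j)%:P * 'X.

Definition ev A : {mpoly R[2]} -> {poly S} :=
  mmap (polyC \o iota) (line_form A).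
HB.instance Definition _ A := GRing.RMorphism.on (ev A).

Lemma evX A i : ev A 'X_i = line_form A i.
Proof. by rewrite /ev mmapX mmap1U. Qed.

Lemma evC A c : ev A c%:MP = (iota c)%:P.
Proof. by rewrite /ev mmapC. Qed.

Lemma evZ A c P : ev A (c *: P) = iota c *: ev A P.
Proof. by rewrite -mul_mpolyC rmorphM /= evC mul_polyC. Qed.

Lemma ev_mon A n i :
  ev A 'X_[mon n i] = line_form A 0 ^+ i * line_form A 1 ^+ (n - i).
Proof. by rewrite mon_varE rmorphM !rmorphXn /= !evX. Qed.

Lemma ev_subst A B P : ev A (subst_form B P) = ev (A *m B) P.
Proof.
elim/mpoly_monomial_ind: P => [|P Q IHP IHQ|c P IHP|i P IHP].
- by rewrite !rmorph1.
- by rewrite !rmorphD /= IHP IHQ.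
- by rewrite linearZ /= !evZ IHP.
rewrite !rmorphM /= IHP; congr (_ * _).
rewrite subst_formX rmorphD /= !evZ /varX /varY !evX /line_form !point_mul.
move: (point alpha A 0) (point alpha A 1) => a b.
move: (point (- alpha) A 0) (point (- alpha) A 1) => a' b'.
by rewrite -!mul_polyC !polyCD !polyCM; ring.
Qed.

Lemma size_ev A n P : P \is n.-homog -> (size (ev A P) <= n.+1)%N.
Proof.
elim/homog_form_ind: n P / => [|n P Q IHP IHQ|n c P IHP|n i P IHP].
- by rewrite rmorph1 size_poly1.
- by rewrite rmorphD (leq_trans (size_polyD _ _)) // geq_max IHP.
- by rewrite evZ (leq_trans (size_scale_leq _ _)).
rewrite rmorphM /= evX (leq_trans (size_polyMleq _ _)) //.
have : (size (line_form A i) <= 2)%N.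
  by rewrite /line_form mul_polyC; apply/leq_sizeP => -[|[|j]] // _;
    rewrite coefD coefC coefZ coefX mulr0 addr0.
by move: IHP; lia.
Qed.

Definition ev_mx n A : 'M[S]_n.+1 := \matrix_(i, j) (ev A 'X_[mon n i])`_j.

Lemma row_ev_mx n A (v : 'rV_n.+1) j :
  (map_mx iota v *m ev_mx n A) 0 j = (ev A (form_of_row v))`_j.
Proof.
rewrite mxE /form_of_row rmorph_sum coef_sum; apply: eq_bigr => i _.
by rewrite /= evZ coefZ !mxE.
Qed.

Lemma sym_mx_ev n A B :
  map_mx iota (sym_mx n B) *m ev_mx n A = ev_mx n (A *m B).
Proof.
apply/row_matrixP => i; rewrite row_mul -map_row /sym_mx rowK.
apply/rowP=> j; rewrite row_ev_mx row_of_formK ?ev_subst ?mxE //.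
by rewrite subst_form_homog // dhomogX /= mdeg_mon.
Qed.

Variable p : nat.
Hypotheses (chS : p \in [pchar S]) (iota_p : forall a, iota a ^+ p = iota a).

Lemma point_exp_p x y A j : x ^+ p = y -> point x A j ^+ p = point y A j.
Proof.
move=> xy; rewrite /point -(pFrobenius_autE chS) rmorphD rmorphM /=.
by rewrite !pFrobenius_autE !iota_p xy.
Qed.

Hypotheses (alphaV : alpha ^+ p = - alpha) (odd_p : odd p).

Lemma alphaNV : (- alpha) ^+ p = alpha.
Proof. by rewrite exprNn alphaV -signr_odd odd_p expr1 mulN1r opprK. Qed.

(** Raising to the power p exchanges alpha and - alpha, hence maps
    zeta + beta zeta' to zeta' + beta^p zeta. *)
Lemma ev_D n A P : P \is n.-homog ->
  ev A (D_form p P)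
    = 'X^p * ev A P *+ n + (1 - 'X^(p.+1)) * (ev A P)^`().
Proof.
have chP : p \in [pchar {poly S}].
  have /andP[pr_p /eqP p0] := chS.
  by rewrite inE pr_p -polyC_natr p0 eqxx.
move=> Ph; apply: D_form_transport Ph => [c|i]; first by rewrite /= evC derivC.
rewrite /= evX /line_form -(pFrobenius_autE chP) rmorphD rmorphM /=.
rewrite !pFrobenius_autE -!rmorphXn /= (point_exp_p _ _ alphaV).
rewrite (point_exp_p _ _ alphaNV) derivD derivM !derivC derivX.
by rewrite exprS; ring.
Qed.

(** By [ev_D] a functional kills the image of D as soon as it kills the
    expressions below for all f of degree at most n. *)
Lemma D_mx_ev n m A (u : 'cV[S]_m.+1) : m = (n + p.-1)%N ->
    (forall f : {poly S}, (size f <= n.+1)%N ->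
      \sum_(j < m.+1)
        ('X^p * f *+ n + (1 - 'X^(p.+1)) * f^`())`_j * u j 0 = 0) ->
  map_mx iota (D_mx R p n m) *m ev_mx m A *m u = 0.
Proof.
have pr_p := pcharf_prime chS.
move=> mE u0; apply/row_matrixP => i; rewrite row0 !row_mul -map_row rowK.
apply/rowP=> l; rewrite ord1 mxE [RHS]mxE.
have Xh : 'X_[mon n i] \is [in R[2], n.-homog].
  by rewrite dhomogX /= mdeg_mon.
rewrite -{2}(u0 (ev A 'X_[mon n i])) ?size_ev //.
apply: eq_bigr => j _; rewrite row_ev_mx row_of_formK ?(ev_D _ Xh) //.
by have := D_form_homog (prime_gt0 pr_p) Xh; rewrite -mE.
Qed.

Variables (T : 'M[R]_2) (tau : S).
Hypotheses (T0 : point alpha T 0 = tau) (T1 : point alpha T 1 = tau * alpha).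

(** T0 and T1 say that (1, alpha) is an eigenvector of T for tau; then
    (1, - alpha) is one for tau^p. *)
Lemma ev_torus n A P j : P \is n.-homog ->
  (ev (T *m A) P)`_j = tau ^+ (n + p.-1 * j) * (ev A P)`_j.
Proof.
move=> Ph; elim/homog_form_ind: n P / Ph j
  => [|n P Q IHP IHQ|n c P IHP|n i P IHP] j.
- rewrite !rmorph1 !coef1; case: j => [|j]; rewrite ?mulr0 //.
  by rewrite muln0 expr0 mulr1.
- by rewrite !rmorphD !coefD IHP IHQ mulrDr.
- by rewrite !evZ !coefZ IHP mulrCA.
have p1 : (p = p.-1.+1)%N by rewrite prednK // prime_gt0 ?(pcharf_prime chS).
have TV0 : point (- alpha) T 0 = tau ^+ p.
  by rewrite -(point_exp_p T 0 alphaV) T0.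
have TV1 : point (- alpha) T 1 = - (tau ^+ p * alpha).
  by rewrite -(point_exp_p T 1 alphaV) T1 exprMn alphaV mulrN.
have lineT : line_form (T *m A) i
    = (tau * point alpha A i)%:P + (tau ^+ p * point (- alpha) A i)%:P * 'X.
  by rewrite /line_form !point_mul T0 T1 TV0 TV1; congr (_%:P + _%:P * 'X);
    rewrite /point; ring.
have linear_coef (a b : S) (f : {poly S}) l :
    ((a%:P + b%:P * 'X) * f)`_l
      = a * f`_l + b * (if l is l'.+1 then f`_l' else 0).
  rewrite mulrDl coefD coefCM -mulrA coefCM coefXM.
  by case: l => //=; rewrite mulr0.
rewrite !rmorphM /= !evX lineT /line_form !linear_coef !IHP.
move: (point alpha A i) (point (- alpha) A i) => a b.
case: j => [|j].
  by rewrite !muln0 !addn0 (exprS tau n); ring.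
have E : tau ^+ p * tau ^+ (n + p.-1 * j) = tau ^+ (n.+1 + p.-1 * j.+1).
  by rewrite -exprD; congr (_ ^+ _); lia.
rewrite IHP mulrDr; congr (_ + _); last by rewrite -E; ring.
by rewrite addSn exprS; ring.
Qed.

Lemma ev_mx_torus n A (u : 'cV[S]_n.+1) w :
    (forall j, u j 0 != 0 -> tau ^+ (n + p.-1 * j) = tau ^+ w) ->
  ev_mx n (T *m A) *m u = tau ^+ w *: (ev_mx n A *m u).
Proof.
move=> uw; apply/colP=> i; rewrite !mxE mulr_sumr; apply: eq_bigr => j _.
rewrite !mxE (@ev_torus n) ?dhomogX /= ?mdeg_mon //.
by have [->|/uw->] := eqVneq (u j 0) 0; rewrite ?mulr0 // mulrA.
Qed.

End Evaluation.

(** * Coefficients of products of sparse polynomials *)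

Section PolyCoef.

Variable S : comNzRingType.

Lemma coef_linear_exp (a b : S) N j :
  ((a%:P + b%:P * 'X) ^+ N)`_j = a ^+ (N - j) * b ^+ j *+ 'C(N, j).
Proof.
rewrite exprDn coef_sum.
under eq_bigr => i _.
  rewrite exprMn -!rmorphXn /= mulrA -rmorphM coefMn coefCM coefXn.
  over.
have [ltjN|leNj] := ltnP j N.+1.
  rewrite (bigD1 (Ordinal ltjN)) //= eqxx mulr1 big1 ?addr0 // => i ij.
  rewrite (_ : j == i = false) ?mulr0 ?mul0rn //.
  apply: contraNF ij => /eqP ji; apply/eqP/val_inj; exact: esym.
rewrite big1 ?bin_small // => i _.
rewrite (_ : j == i = false) ?mulr0 ?mul0rn //.
by have := ltn_ord i; lia.
Qed.

(** There is no carry: in base p the exponent has digits l and j, and the first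
    factor only sees l, the second only j. *)
Lemma coef_sparse_mul p N (g : {poly S}) l j : (size g <= p)%N -> (j < p)%N ->
  ((1 + 'X^p) ^+ N * g)`_(p * l + j) = g`_j *+ 'C(N, l).
Proof.
move=> szg ltjp; rewrite exprDn mulr_suml coef_sum.
under eq_bigr => i _.
  rewrite expr1n mul1r -exprM mulrnAl coefMn coefXnM.
  over.
have F i : (i != l) ->
    (if (p * l + j < p * i)%N then 0 else g`_(p * l + j - p * i)) = 0.
  case: ifP => // /negbT; rewrite -leqNgt => le il.
  by rewrite nth_default // (leq_trans szg) //; nia.
have [ltlN|leNl] := ltnP l N.+1.
  rewrite (bigD1 (Ordinal ltlN)) //= big1 ?addr0 => [|i il]; last first.
    by rewrite F ?mul0rn.
  by rewrite ltnNge leq_addr /= addKn.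
rewrite big1 ?bin_small // => i _; rewrite F ?mul0rn //.
by have := ltn_ord i; lia.
Qed.

Lemma coef_mul_CDXn p c (q g : {poly S}) j : (j < p)%N ->
  ((c%:P + 'X^p * q) * g)`_j = c * g`_j.
Proof.
by move=> ltjp; rewrite mulrDl coefD coefCM -mulrA coefXnM ltjp addr0.
Qed.

Lemma bin_pred_pchar p j : p \in [pchar S] -> (j < p)%N ->
  'C(p.-1, j)%:R = (-1) ^+ j :> S.
Proof.
move=> chS; have pr_p := pcharf_prime chS; have p0 := prime_gt0 pr_p.
elim: j => [|j IHj] ltj; first by rewrite bin0.
have : 'C(p, j.+1)%:R = 0 :> S.
  apply/eqP; rewrite -(dvdn_pcharf chS) prime_dvd_bin //; lia.
rewrite -{1}(prednK p0) binS natrD IHj ?(ltnW ltj) // => /eqP.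
by rewrite addr_eq0 exprS mulN1r => /eqP.
Qed.

Lemma sum_multiples q m (F : nat -> S) : (0 < q)%N ->
  \sum_(j < m.+1) (if (q %| j)%N then F (j %/ q)%N else 0)
    = \sum_(l < (m %/ q).+1) F l.
Proof.
move=> q0; elim: m => [|m IHm].
  by rewrite div0n !big_ord_recl !big_ord0 /= dvdn0 div0n.
rewrite big_ord_recr /= IHm divnS //.
case: (q %| m.+1)%N; last by rewrite addr0.
by rewrite add1n [RHS]big_ord_recr.
Qed.

End PolyCoef.

(** * Two functionals that vanish on the image of D *)

Section Functionals.

Variables (S : fieldType) (p s k n m : nat).
Hypotheses (chS : p \in [pchar S]) (s_gt0 : (0 < s)%N) (sk : (s + k < p)%N).
Hypotheses (nE : n = (s + k * p.+1)%N) (mE : m = (n + p.-1)%N).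

Let pr_p : prime p := pcharf_prime chS.
Let p_gt1 : (1 < p)%N := prime_gt1 pr_p.

Lemma pchar_natr_eq (a b : nat) : a = b %[mod p] -> a%:R = b%:R :> S.
Proof.
have mod_natr c : c%:R = (c %% p)%:R :> S.
  by rewrite {1}(divn_eq c p) natrD natrM (pcharf0 chS) mulr0 add0r.
by move=> ab; rewrite mod_natr ab -mod_natr.
Qed.

Lemma pchar_natr_neq0 a : (0 < a < p)%N -> a%:R != 0 :> S.
Proof. by move=> /andP[a0 ap]; rewrite -(dvdn_pcharf chS) gtnNdvd. Qed.

Lemma pchar_fact_neq0 a : (a < p)%N -> a`!%:R != 0 :> S.
Proof.
elim: a => [|a IHa] ltap; first by rewrite oner_eq0.
by rewrite factS natrM mulf_neq0 ?IHa ?(ltnW ltap) // pchar_natr_neq0.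
Qed.

(** Up to the factor (s - 1) (s + k - 1)!, this is (-1)^l / 'C(s + k - 1, l):
    the coefficients of the contraction of V_(s+k-1) (x) V_(k+1) onto V_(s-2).
    For s = 1 that target is zero, and the factor s - 1 makes the functional
    zero. *)
Definition hw_coef (l : nat) : S :=
  s.-1%:R * ((-1) ^+ l * l`!%:R * (s + k - 1 - l)`!%:R).

(** The two-term recursion that makes [hw_functional_D] telescope. *)
Lemma hw_coefS l : (l <= k)%N ->
  hw_coef l.+1 * (s + k - l.+1)%:R = - (hw_coef l * l.+1%:R).
Proof.
rewrite /hw_coef => lek; have [s1|s2] := leqP s 1.
  by rewrite (_ : s.-1 = 0%N) ?mul0r ?oppr0 //; lia.
have -> : (s + k - l.+1 = (s + k - 1 - l.+1).+1)%N by lia.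
have -> : (s + k - 1 - l = (s + k - 1 - l.+1).+1)%N by lia.
by rewrite !factS !natrM exprS; ring.
Qed.

(** The coefficients of index divisible by p + 1 are those of weight m, because
    tau^(p^2 - 1) = 1. *)
Definition hw_functional : 'cV[S]_m.+1 :=
  \col_j (if (p.+1 %| j)%N then hw_coef (j %/ p.+1)%N else 0).

Definition top_functional : 'cV[S]_m.+1 := \col_j (j == p.-1 :> nat)%:R.

Lemma coef_D_ode (f : {poly S}) j :
  ('X^p * f *+ n + (1 - 'X^(p.+1)) * f^`())`_j =
    (if (j < p)%N then 0 else f`_(j - p) *+ n)
    + (f`_j.+1 *+ j.+1 - (if (j < p.+1)%N then 0 else f`_(j - p) *+ (j - p))).
Proof.
rewrite coefD coefMn coefXnM mulrBl mul1r coefB coefXnM !coef_deriv.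
congr (_ + (_ - _)); first by case: ifP; rewrite ?mul0rn.
by case: ltnP => // lepj; rewrite subnS prednK // subn_gt0.
Qed.

Lemma top_functionalE (g : nat -> S) :
  \sum_(j < m.+1) g j * top_functional j 0 = g p.-1.
Proof.
have ltpm : (p.-1 < m.+1)%N by rewrite mE; lia.
rewrite (bigD1 (Ordinal ltpm)) //= big1 => [|j jp]; last first.
  by rewrite mxE (_ : _ == _ = false) ?mulr0 //; apply: negbTE.
by rewrite mxE eqxx mulr1 addr0.
Qed.

Lemma top_functional_D (f : {poly S}) :
  \sum_(j < m.+1) ('X^p * f *+ n + (1 - 'X^(p.+1)) * f^`())`_j
    * top_functional j 0 = 0.
Proof.
set h : {poly S} := 'X^p * f *+ n + _.
rewrite (top_functionalE (fun j => h`_j)) coef_D_ode prednK ?prime_gt0 //.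
by rewrite leqnn leqnSn -mulr_natr (pcharf0 chS) mulr0 subr0 addr0.
Qed.

Lemma m_divn : (1 < s)%N -> (m %/ p.+1)%N = k.+1.
Proof.
move=> s2; have -> : m = (k.+1 * p.+1 + (s - 2))%N by rewrite mE nE; lia.
by rewrite divnMDl // divn_small ?addn0 //; lia.
Qed.

Lemma hw_functionalE (g : nat -> S) :
  \sum_(j < m.+1) g j * hw_functional j 0
    = \sum_(l < k.+2) g (l * p.+1)%N * hw_coef l.
Proof.
have [s2|s2] := ltnP 1 s; last first.
  have c0 l : hw_coef l = 0.
    by rewrite /hw_coef (_ : s.-1 = 0%N) ?mul0r //; lia.
  rewrite !big1 // => i _; first by rewrite c0 mulr0.
  by rewrite mxE c0 if_same mulr0.
rewrite -(m_divn s2).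
rewrite -(sum_multiples m (fun l => g (l * p.+1)%N * hw_coef l)) //.
apply: eq_bigr => j _; rewrite mxE.
by case: ifP => [/divnK->|_]; rewrite ?mulr0.
Qed.

(** Only the coefficients f_(l (p + 1) + 1) occur, each in two consecutive
    terms, which cancel.  The last one has index greater than n. *)
Lemma hw_functional_D (f : {poly S}) : (size f <= n.+1)%N ->
  \sum_(j < m.+1) ('X^p * f *+ n + (1 - 'X^(p.+1)) * f^`())`_j
    * hw_functional j 0 = 0.
Proof.
move=> szf; set h : {poly S} := 'X^p * f *+ n + _.
rewrite (hw_functionalE (fun j => h`_j)).
(* The partial sums of the telescoping series. *)
pose a l := hw_coef l * l.+1%:R * f`_(l * p.+1).+1.
have step l : (l <= k.+1)%N ->
    h`_(l * p.+1) * hw_coef l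
      = a l - (if l is l'.+1 then a l' else 0).
  move=> lek; rewrite (coef_D_ode f).
  have -> : f`_(l * p.+1).+1 *+ (l * p.+1).+1 = l.+1%:R * f`_(l * p.+1).+1.
    rewrite -[LHS]mulr_natl; congr (_ * _); apply: pchar_natr_eq.
    by rewrite (_ : (l * p.+1).+1 = l * p + l.+1)%N ?modnMDl //; lia.
  case: l lek => [|l] lek.
    by rewrite mul0n !ltnS leq0n prime_gt0 //= /a add0r !subr0 mul0n; ring.
  have -> : (l.+1 * p.+1 - p = (l * p.+1).+1)%N by lia.
  have -> : (l.+1 * p.+1 < p)%N = false by lia.
  have -> : (l.+1 * p.+1 < p.+1)%N = false by lia.
  (* n - (l (p + 1) + 1) is a true difference only for indices up to n. *)
  have [lt|le] := ltnP n (l * p.+1).+1.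
    rewrite /a [f`_(l * p.+1).+1]nth_default ?(leq_trans szf) //.
    by rewrite !mul0rn mulr0; ring.
  have {}nE2 : n%:R - (l * p.+1).+1%:R = (s + k - l.+1)%:R :> S.
    rewrite -natrB //; apply: pchar_natr_eq.
    rewrite (_ : n - _ = (k - l) * p + (s + k - l.+1))%N ?modnMDl //.
    have : (k * p = l * p + (k - l) * p)%N by rewrite -mulnDl subnKC //; lia.
    by move: lek s_gt0; rewrite nE !mulnS; lia.
  have := hw_coefS lek; rewrite -nE2 /a; set g := f`_(l * p.+1).+1 => c.
  rewrite -[g *+ n]mulr_natr -[g *+ _.+1]mulr_natr.
  have -> (e N M : S) : (g * N + (e - g * M)) * hw_coef l.+1
     = e * hw_coef l.+1 + g * (hw_coef l.+1 * (N - M)) by ring.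
  by rewrite c; ring.
have tele N : (N <= k.+1)%N -> \sum_(l < N.+1)
    h`_(l * p.+1) * hw_coef l = a N.
  elim: N => [|N IHN] ltN; first by rewrite big_ord1 step // subr0.
  by rewrite big_ord_recr /= IHN ?(ltnW ltN) // step // subrKC.
rewrite tele // /a nth_default ?mulr0 // (leq_trans szf) // nE; lia.
Qed.

Section Values.

Variables z z' : S.
Hypotheses (zp : z ^+ p = z') (z'p : z' ^+ p = z).
Local Notation Z := (z%:P + z'%:P * 'X).

Lemma one_addX_exp_p : (1 + 'X) ^+ p = 1 + 'X^p :> {poly S}.
Proof.
have chP : p \in [pchar {poly S}].
  by rewrite inE pr_p -polyC_natr (pcharf0 chS) eqxx.
by rewrite -(pFrobenius_autE chP) rmorphD /= !pFrobenius_autE expr1n.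
Qed.

Lemma Z_exp_p : Z ^+ p = z'%:P + 'X^p * z%:P.
Proof.
have chP : p \in [pchar {poly S}].
  by rewrite inE pr_p -polyC_natr (pcharf0 chS) eqxx.
rewrite -(pFrobenius_autE chP) rmorphD rmorphM /= !pFrobenius_autE.
by rewrite -!rmorphXn /= zp z'p mulrC.
Qed.

Lemma size_Z_exp N : (size (Z ^+ N) <= N.+1)%N.
Proof.
apply/leq_sizeP => j ltNj.
by rewrite coef_linear_exp bin_small.
Qed.

(** Since (1 + X)^p = 1 + X^p, the coefficient of index l (p + 1) is
    'C(k + 1, l) times one of index l of a power of Z.  The factorials of
    [hw_coef] cancel its binomial coefficient, and what remains is the binomial
    expansion of (z - z')^(k + 1). *)
Lemma hw_functional_value :
  \sum_(j < m.+1) ((1 + 'X) ^+ (p * k.+1) * Z ^+ (s + k - 1))`_j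
      * hw_functional j 0
    = s.-1%:R * (s + k - 1)`!%:R * (z ^+ (s - 2) * (z - z') ^+ k.+1).
Proof.
have [s1|s2] := leqP s 1.
  rewrite (_ : s.-1 = 0%N) ?mul0r; last by lia.
  rewrite big1 // => j _.
  rewrite mxE /hw_coef (_ : s.-1 = 0%N) ?mul0r; last by lia.
  by rewrite if_same mulr0.
set h : {poly S} := _ * _; rewrite (hw_functionalE (fun j => h`_j)) /h.
rewrite exprBn !mulr_sumr.
apply: eq_bigr => -[l /= ltl] _; rewrite ltnS in ltl.
have -> : (l * p.+1 = p * l + l)%N by rewrite mulnS addnC mulnC.
rewrite exprM one_addX_exp_p coef_sparse_mul; last first.
- by move: ltl; lia.
- by rewrite (leq_trans (size_Z_exp _)) //; lia.
rewrite coef_linear_exp /hw_coef.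
have lemu : (l <= s + k - 1)%N by lia.
rewrite -(bin_fact lemu) !natrM.
have -> : (s + k - 1 - l = (s - 2) + (k.+1 - l))%N by lia.
by rewrite exprD; ring.
Qed.

(** The product is a polynomial in X^p times one of degree less than p - 1. *)
Lemma top_functional_value0 :
  \sum_(j < m.+1) ((1 + 'X) ^+ (p * k.+1) * Z ^+ (s + k - 1))`_j
      * top_functional j 0 = 0.
Proof.
set h : {poly S} := _ * _; rewrite (top_functionalE (fun j => h`_j)) /h.
rewrite exprM one_addX_exp_p.
have szZ : (size (Z ^+ (s + k - 1)) <= p.-1)%N.
  by rewrite (leq_trans (size_Z_exp _)) //; lia.
have := @coef_sparse_mul _ p k.+1 (Z ^+ (s + k - 1)) 0 p.-1.
rewrite muln0 add0n => ->; first by rewrite nth_default ?mul0rn.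
- by rewrite (leq_trans szZ) ?leq_pred.
- by lia.
Qed.

Hypothesis odd_p : odd p.

(** Modulo X^p the power of Z reduces to z'^k Z^(p - 1), and the binomial
    coefficients of exponent p - 1 are signs. *)
Lemma top_functional_value :
  \sum_(j < m.+1) ((1 + 'X) ^+ (s + k) * Z ^+ (k * p + p.-1))`_j
      * top_functional j 0
    = z' ^+ (p.-1 - s) * (z' - z) ^+ (s + k).
Proof.
set h : {poly S} := _ * _; rewrite (top_functionalE (fun j => h`_j)) /h.
rewrite mulrC exprD mulnC exprM Z_exp_p.
have [q qE] : exists q, (z'%:P + 'X^p * z%:P) ^+ k = (z' ^+ k)%:P + 'X^p * q.
  elim: k => [|i [q qE]]; first by exists 0; rewrite mulr0 addr0.
  exists (z%:P * (z' ^+ i)%:P + (z'%:P + 'X^p * z%:P) * q).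
  by rewrite exprS qE exprS rmorphM /=; ring.
rewrite qE -mulrA coef_mul_CDXn; last by lia.
rewrite [_ ^+ p.-1 * _]mulrC [(1 + 'X) ^+ _]exprDn mulr_suml coef_sum.
have -> : (p.-1 - s = k + (p.-1 - (s + k)))%N by lia.
rewrite exprD -mulrA; congr (_ * _).
rewrite exprBn mulr_sumr; apply: eq_bigr => -[i /= lti] _.
rewrite expr1n mul1r mulrnAl coefMn coefXnM ltnNge.
rewrite (_ : (i <= p.-1)%N); last by lia.
rewrite coef_linear_exp (_ : p.-1 - (p.-1 - i) = i)%N; last by lia.
rewrite -[in LHS]mulr_natr bin_pred_pchar //; last by lia.
have -> : (p.-1 - i = (s + k - i) + (p.-1 - (s + k)))%N by lia.
rewrite exprD.
have -> : (-1) ^+ (s + k - i + (p.-1 - (s + k))) = (-1) ^+ i :> S.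
  rewrite -signr_odd -[RHS]signr_odd; congr (_ ^+ _); congr nat_of_bool.
  by lia.
by rewrite /=; ring.
Qed.

End Values.

End Functionals.

(** * Power sums over a finite field of prime order *)

Section PowerSums.

Variables (F : finFieldType) (S : fieldType) (iota : {rmorphism F -> S}).
Variable p : nat.
Hypotheses (cardF : #|F| = p) (chS : p \in [pchar S]).

Lemma finField_exp_pred (b : F) : b != 0 -> b ^+ p.-1 = 1.
Proof.
move=> b0; apply: (mulfI b0).
rewrite -exprS mulr1 prednK ?prime_gt0 ?(pcharf_prime chS) //.
by rewrite -cardF expf_card.
Qed.

Lemma exp_neq1_exists j : ~~ (p.-1 %| j)%N ->
  exists2 b : F, b != 0 & b ^+ j != 1.
Proof.
move=> ndvd; have r0 : (0 < j %% p.-1)%N by rewrite lt0n.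
have [b /andP[b0 bj]|all1] := pickP (fun b : F => (b != 0) && (b ^+ j != 1)).
  by exists b.
have : (size (enum (predC1 (0%R : F))) <= j %% p.-1)%N.
  apply: max_unity_roots => //; last exact: enum_uniq.
  apply/allP => b; rewrite mem_enum !inE => b0; apply/unity_rootP.
  have := all1 b; rewrite b0 /= => /negbFE/eqP <-.
  rewrite {2}(divn_eq j p.-1) exprD mulnC exprM finField_exp_pred //.
  by rewrite expr1n mul1r.
rewrite -cardE cardC1 cardF leqNgt ltn_pmod //.
by have := prime_gt1 (pcharf_prime chS); lia.
Qed.

Lemma sum_units_exp j :
  \sum_(b : F | b != 0) iota b ^+ j = if (p.-1 %| j)%N then -1 else 0.
Proof.
have p0 : (0 < p)%N := prime_gt0 (pcharf_prime chS).
have cardU : \sum_(b : F | b != 0) (1 : S) = -1.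
  rewrite sumr_const (_ : #|_| = p.-1); last first.
    by rewrite -cardF -(cardC1 (0 : F)); apply: eq_card => b; rewrite !inE.
  by apply/eqP; rewrite -subr_eq0 opprK -mulrSr prednK // (pcharf0 chS).
case: ifP => [/dvdnP[c ->]|/negbT/exp_neq1_exists[c c0 cj]].
  rewrite -[RHS]cardU; apply: eq_bigr => b b0.
  by rewrite mulnC exprM -rmorphXn finField_exp_pred // rmorph1 expr1n.
set s := LHS; have : iota c ^+ j * s = s.
  rewrite /s mulr_sumr [RHS](reindex_inj (mulfI c0)) /=.
  apply: eq_big => [b|b b0]; first by rewrite mulf_eq0 (negbTE c0).
  by rewrite rmorphM exprMn.
move/eqP; rewrite -subr_eq0 -[X in _ - X]mul1r -mulrBl mulf_eq0.
move=> /orP[|/eqP //]; rewrite subr_eq0 -rmorphXn -(rmorph1 iota).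
by rewrite (inj_eq (fmorph_inj _)) (negbTE cj).
Qed.

Lemma sum_exp_small j : (j < p.-1.*2)%N ->
  \sum_(a : F) iota a ^+ j = if j == p.-1 then -1 else 0.
Proof.
have p1 := prime_gt1 (pcharf_prime chS) => ltj.
rewrite (bigID (fun a => a != 0)) /= sum_units_exp.
rewrite (big_pred1 0) => [|a]; last by rewrite negbK.
rewrite rmorph0; case: j ltj => [|j] ltj.
  by rewrite dvdn0 expr0 addNr (_ : 0%N == _ = false) //; lia.
rewrite expr0n addr0; congr (if _ then _ else _).
apply/idP/eqP => [/dvdnP[[|[|c]] //]|->]; last exact: dvdnn.
  by rewrite mul1n.
by move: ltj => /[swap] ->; rewrite -addnn !mulSn addnA ltnNge leq_addr.
Qed.

Lemma bin_pred_eq0 N : (p <= N < p.-1.*2)%N -> 'C(N, p.-1)%:R = 0 :> S.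
Proof.
case/andP=> lepN ltN; have p1 := prime_gt1 (pcharf_prime chS).
have leN : (p.-1 <= N)%N by lia.
have /eqP : (N`!%:R : S) = 0.
  by apply/eqP; rewrite -(dvdn_pcharf chS) dvdn_fact // lepN (ltnW p1).
rewrite -(bin_fact leN) !natrM !mulf_eq0 => /orP[/eqP//|/orP[]] /idPn[];
  by apply: (pchar_fact_neq0 chS); lia.
Qed.

(** In the binomial expansion only the power p - 1 of a has a nonzero sum, and
    its coefficient 'C(N, p - 1) vanishes for p <= N < 2 (p - 1). *)
Lemma sum_shift_exp (c : S) N : (N < p.-1.*2)%N ->
  \sum_(a : F) (iota a + c) ^+ N = if N == p.-1 then -1 else 0.
Proof.
move=> ltN; have p1 := prime_gt1 (pcharf_prime chS).
under eq_bigr do rewrite addrC exprDn.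
rewrite exchange_big /=.
have E (i : 'I_N.+1) : \sum_(a : F) c ^+ (N - i) * iota a ^+ i *+ 'C(N, i)
   = if i == p.-1 :> nat then - (c ^+ (N - i) *+ 'C(N, i)) else 0.
  under eq_bigr do rewrite -mulrnAl.
  rewrite -mulr_sumr sum_exp_small; last by have := ltn_ord i; lia.
  by case: ifP => _; rewrite ?mulrN1 ?mulr0.
under eq_bigr do rewrite E.
have [ltNp|lepN] := ltnP N p.-1.
  rewrite big1 => [|i _]; first by rewrite (ltn_eqF ltNp).
  by rewrite ltn_eqF // (leq_trans (ltn_ord i)).
rewrite (bigD1 (Ordinal (lepN : (p.-1 < N.+1)%N))) //= eqxx.
rewrite big1 ?addr0 => [|i ip].
  have [->|neN] := eqVneq N p.-1; first by rewrite subnn binn.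
  by rewrite -mulr_natr bin_pred_eq0 ?mulr0 ?oppr0 //; lia.
by rewrite -val_eqE /= in ip; rewrite (negbTE ip).
Qed.

(** Expand a - c = (a + c) - 2 c; one exponent of a + c survives. *)
Lemma sum_shift_exp2 (c : S) A i :
    (A <= p - 2)%N -> (p.-1 - A <= i <= p.-1)%N ->
  \sum_(a : F) (iota a + c) ^+ A * (iota a - c) ^+ i
    = - ('C(i, p.-1 - A)%:R * (- (c *+ 2)) ^+ (i - (p.-1 - A))).
Proof.
move=> leA /andP[lei ltip]; have p1 := prime_gt1 (pcharf_prime chS).
have E (a : F) : (iota a + c) ^+ A * (iota a - c) ^+ i =
  \sum_(j < i.+1)
    ((- (c *+ 2)) ^+ (i - j) *+ 'C(i, j)) * (iota a + c) ^+ (A + j).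
  have -> : iota a - c = - (c *+ 2) + (iota a + c) by ring.
  rewrite [(- _ + _) ^+ i]exprDn mulr_sumr.
  by apply: eq_bigr => j _; rewrite exprD; ring.
under eq_bigr do rewrite E.
rewrite exchange_big /= (bigD1 (Ordinal (lei : (_ < i.+1)%N))) //=.
rewrite -mulr_sumr sum_shift_exp; last by lia.
rewrite (_ : A + _ == p.-1)%N; last by apply/eqP; lia.
rewrite big1 => [|j jp]; first by rewrite addr0 -mulr_natr; ring.
rewrite -mulr_sumr sum_shift_exp; last by have := ltn_ord j; lia.
rewrite (_ : A + j == p.-1 = false)%N ?mulr0 //.
by rewrite -val_eqE /= in jp; apply: contraNF jp => /eqP <-; rewrite addKn.
Qed.

End PowerSums.

(** * Relations along an orbit of the affine group *)

Section AffineOrbit.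

Variables (F : finFieldType) (S : fieldType) (iota : {rmorphism F -> S}).
Variable p : nat.
Hypotheses (cardF : #|F| = p) (chS : p \in [pchar S]).

(** The summand is homogeneous in (a, b), so replacing a by a b separates the
    two sums. *)
Lemma mirabolic_sum_neq0 (c : S) e A i N :
    c != 0 -> odd p -> (A <= p - 2)%N -> (p.-1 - A <= i <= p.-1)%N ->
    (p.-1 %| e + A + i + N)%N ->
  \sum_(a : F) \sum_(b : F | b != 0) iota b ^+ e *
     ((iota a + iota b * c) ^+ A * (iota a - iota b * c) ^+ i
       * (iota a + iota b * c - (iota a - iota b * c)) ^+ N) != 0.
Proof.
move=> c0 odd_p leA lei dvd; have p1 := prime_gt1 (pcharf_prime chS).
rewrite exchange_big /=.
under eq_bigr => b b0.
  rewrite (reindex_inj (mulfI b0)) /=.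
  under eq_bigr => a _.
    rewrite rmorphM -mulrDr -mulrBr -mulrBr !exprMn.
    have -> : iota a + c - (iota a - c) = c *+ 2 by ring.
    have -> (x y z : S) : iota b ^+ e *
        (iota b ^+ A * x * (iota b ^+ i * y) * (iota b ^+ N * z))
      = (iota b ^+ (e + A + i + N) * z) * (x * y) by rewrite !exprD; ring.
    over.
  rewrite -mulr_sumr (sum_shift_exp2 _ cardF chS) //.
  over.
rewrite -2!mulr_suml (sum_units_exp _ cardF chS) dvd.
have c2 : c *+ 2 != 0.
  rewrite -mulr_natr mulf_neq0 // (pchar_natr_neq0 chS) //=.
  by case: p odd_p p1 => [|[|[|]]].
rewrite !mulf_neq0 ?oppr_eq0 ?oner_eq0 ?expf_neq0 //.
rewrite ?mulf_neq0 ?expf_neq0 ?oppr_eq0 //.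
case/andP: lei => lei lip; apply/negP => /eqP C0.
have : (i`!%:R : S) == 0 by rewrite -(bin_fact lei) natrM C0 mul0r.
by apply/negP; apply: (pchar_fact_neq0 chS); lia.
Qed.

Variables (V : lmodType S) (v : F -> F -> V).
Hypothesis v_shift : forall t, exists f : {linear V -> V},
  forall a b, b != 0 -> v (a + t) b = f (v a b).
Hypothesis v_scale : forall c, c != 0 -> exists f : {linear V -> V},
  forall a b, b != 0 -> v (a * c) (b * c) = f (v a b).

Let relation (w : F -> F -> S) :=
  \sum_(a : F) \sum_(b : F | b != 0) w a b *: v a b = 0.

Let relation_sum (I : finType) (x : I -> S) (w : I -> F -> F -> S) :
  (forall i, relation (w i)) -> relation (fun a b => \sum_i x i * w i a b).
Proof.
move=> rw; rewrite /relation.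
under eq_bigr => a _.
  under eq_bigr do rewrite scaler_suml.
  rewrite exchange_big /=.
  over.
rewrite exchange_big big1 //= => i _.
transitivity (x i *: \sum_(a : F) \sum_(b : F | b != 0) w i a b *: v a b).
  rewrite scaler_sumr; apply: eq_bigr => a _.
  by rewrite scaler_sumr; apply: eq_bigr => b _; rewrite scalerA.
by rewrite (rw i) scaler0.
Qed.

Let relation_shift t w : relation w -> relation (fun a b => w (a - t) b).
Proof.
move=> rw; have [f fE] := v_shift t.
rewrite /relation (reindex_inj (addIr t)) /=.
transitivity (f (\sum_(a : F) \sum_(b : F | b != 0) w a b *: v a b));
  last by rewrite rw linear0.
rewrite linear_sum; apply: eq_bigr => a _.
by rewrite linear_sum; apply: eq_bigr => b b0; rewrite linearZ /= addrK fE.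
Qed.

Let relation_scale c w : c != 0 ->
  relation w -> relation (fun a b => w (a / c) (b / c)).
Proof.
move=> c0 rw; have [f fE] := v_scale c0.
rewrite /relation (reindex_inj (mulIf c0)) /=.
transitivity (f (\sum_(a : F) \sum_(b : F | b != 0) w a b *: v a b));
  last by rewrite rw linear0.
rewrite linear_sum; apply: eq_bigr => a _.
rewrite linear_sum [LHS](reindex_inj (mulIf c0)) /=.
apply: eq_big => [b|b]; first by rewrite mulf_eq0 (negbTE c0) orbF.
by rewrite mulf_eq0 (negbTE c0) orbF => b0; rewrite linearZ /= !mulfK // fE.
Qed.

Let relation_ext w1 w2 : (forall a b, b != 0 -> w1 a b = w2 a b) ->
  relation w1 -> relation w2.
Proof.
rewrite /relation => E E1; rewrite -[RHS]E1; apply: eq_bigr => a _.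
by apply: eq_bigr => b b0; rewrite E.
Qed.

(** A group of order p acting in characteristic p on a nonzero space has a
    nonzero fixed vector.  Here the first nonzero moment of w along translations
    is fixed, because translating it adds lower moments.  One of the moments 0
    and p - 1 is nonzero, because 1 - t^(p - 1) is the indicator of t = 0. *)
Let relation_unipotent w : relation w -> (exists a b, b != 0 /\ w a b != 0) ->
  exists f : F -> S, relation (fun _ b => f b) /\ exists2 b, b != 0 & f b != 0.
Proof.
move=> rw [a0 [b0 [b0_neq0 wab]]].
pose mom j a b := \sum_(t : F) iota t ^+ j * w (a + t) b.
have r_mom j : relation (mom j).
  apply: relation_sum => t; have := relation_shift (- t) rw.
  by apply: relation_ext => a b _; rewrite opprK.
pose nz j := [exists a, [exists b, (b != 0) && (mom j a b != 0)]].
have : exists j, nz j.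
  have E : w a0 b0 = mom 0 a0 b0 - mom p.-1 a0 b0.
    rewrite /mom -sumrB (bigD1 0) //= big1 => [|t t0].
      rewrite addr0 expr0 mul1r addr0 rmorph0 expr0n.
      rewrite (_ : (p.-1 == 0)%N = false) ?mul0r ?subr0 //.
      by have := prime_gt1 (pcharf_prime chS); lia.
    by rewrite expr0 -rmorphXn (finField_exp_pred cardF chS) // rmorph1 subrr.
  have [m0|m0] := eqVneq (mom 0%N a0 b0) 0.
    exists p.-1; apply/existsP; exists a0; apply/existsP; exists b0.
    by move: wab; rewrite E m0 sub0r oppr_eq0 b0_neq0.
  exists 0%N; apply/existsP; exists a0; apply/existsP; exists b0.
  by rewrite b0_neq0.
move=> /ex_minnP[j /existsP[a1 /existsP[b1 /andP[b1_neq0 momj]]] minj].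
have lower i a b : (i < j)%N -> b != 0 -> mom i a b = 0.
  move=> ltij b_neq0; apply/eqP; apply: contraTT ltij => mi; rewrite -leqNgt.
  apply: minj; apply/existsP; exists a; apply/existsP; exists b.
  by rewrite b_neq0.
have inv a b : b != 0 -> mom j a b = mom j 0 b.
  move=> b_neq0; rewrite {1}/mom (reindex_inj (addIr (- a))) /=.
  under eq_bigr => t _.
    rewrite [a + _]addrC subrK rmorphB addrC exprDn mulr_suml.
    over.
  rewrite exchange_big /= big_ord_recr /= subnn.
  rewrite big1 ?add0r => [|i _].
    by apply: eq_bigr => t _; rewrite expr0 mul1r binn add0r.
  transitivity ((- iota a) ^+ (j - i) *+ 'C(j, i) * mom i 0 b);
    last by rewrite lower // mulr0.
  by rewrite mulr_sumr; apply: eq_bigr => t _; rewrite add0r; ring.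
exists (mom j 0); split.
  by apply: relation_ext (r_mom j) => a b b_neq0; rewrite inv.
by exists b1; rewrite // -(inv a1).
Qed.

(** A translation invariant relation is a function f of b, and a combination of
    its dilates is a multiple of b^e by the e-th Fourier coefficient of f on the
    multiplicative group.  Some Fourier coefficient is nonzero. *)
Lemma affine_orbit_relation w :
    \sum_(a : F) \sum_(b : F | b != 0) w a b *: v a b = 0 ->
    (exists a b, b != 0 /\ w a b != 0) ->
  exists2 e, (e < p.-1)%N &
    \sum_(a : F) \sum_(b : F | b != 0) iota b ^+ e *: v a b = 0.
Proof.
move=> rw nzw; have [f [rf [b0 b0_neq0 fb0]]] := relation_unipotent rw nzw.
have iota0 b : b != 0 -> iota b != 0 by rewrite fmorph_eq0.
pose M e := \sum_(c : F | c != 0) iota c ^- e * f c.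
have rM e : relation (fun _ b => M e * iota b ^+ e).
  pose x (c : F) : S := if c != 0 then iota c ^+ e else 0.
  have r0 : relation (fun _ _ => 0).
    by apply: big1 => a _; apply: big1 => b _; rewrite scale0r.
  pose g (c _ b : F) : S := if c != 0 then f (b / c) else 0.
  apply: (relation_ext _ (@relation_sum F x g _)) => [a b b_neq0|c]; last first.
    rewrite /g.
    have [_|c0] := eqVneq c 0; first exact: r0.
    exact: (relation_scale c0 rf).
  rewrite (bigD1 0) //= /x /g eqxx mul0r add0r /M mulr_suml.
  rewrite (reindex_onto (fun c => b / c) (fun c => b / c)) => [|c c0] /=;
    last first.
    by rewrite invfM invrK mulrA mulfV // mul1r.
  apply: eq_big => [c|c /andP[c0 _]].
    rewrite mulf_eq0 (negbTE b_neq0) invr_eq0 /=.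
    have [->|c0] := eqVneq c 0; rewrite //= invfM invrK mulrA mulfV // mul1r.
    by rewrite eqxx.
  rewrite c0 (_ : b / (b / c) = c); last first.
    by rewrite invfM invrK mulrA mulfV // mul1r.
  have c0' : c != 0 by apply: contraNneq c0 => ->; rewrite invr0 mulr0.
  by rewrite fmorph_div expr_div_n; ring.
(* Fourier inversion; p - 1 = -1 in S. *)
have sumM : \sum_(e < p.-1) iota b0 ^+ e * M e = - f b0.
  under eq_bigr do rewrite mulr_sumr.
  rewrite exchange_big /= (bigD1 b0) //=.
  rewrite [X in _ + X]big1 ?addr0 => [|c /andP[c0 cb]].
    under eq_bigr => e _ do rewrite mulrA mulfV ?expf_neq0 ?iota0 // mul1r.
    rewrite sumr_const card_ord -mulN1r -mulr_natl; congr (_ * _).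
    apply/eqP; rewrite -subr_eq0 opprK natr1 prednK ?(pcharf0 chS) //.
    exact: prime_gt0 (pcharf_prime chS).
  have u1 : iota (b0 / c) - 1 != 0.
    rewrite subr_eq0 -(rmorph1 iota) (inj_eq (fmorph_inj _)).
    by apply: contraNneq cb => /(canRL (mulfVK c0)); rewrite mul1r => ->.
  apply: (mulfI u1); rewrite mulr0.
  under eq_bigr => e _ do rewrite mulrA -expr_div_n -fmorph_div.
  rewrite -mulr_suml mulrA -subrX1 -rmorphXn (finField_exp_pred cardF chS).
    by rewrite rmorph1 subrr mul0r.
  by rewrite mulf_neq0 ?invr_eq0.
have [e Me] : exists e : 'I_p.-1, M e != 0.
  apply/existsP; apply: contraNT fb0; rewrite negb_exists => /forallP M0.
  rewrite -oppr_eq0 -sumM big1 // => e _; have := M0 e.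
  by rewrite negbK => /eqP->; rewrite mulr0.
exists e => //; apply: (scalerI Me); rewrite scaler0 -[RHS](rM e) scaler_sumr.
apply: eq_bigr => a _; rewrite scaler_sumr; apply: eq_bigr => b _.
by rewrite scalerA.
Qed.

End AffineOrbit.

(** * A functional with a cyclic orbit *)

Section TensorProduct.

Variable K : fieldType.

Lemma tprodDl m1 n1 m2 n2 (A A' : 'M[K]_(m1, n1)) (B : 'M[K]_(m2, n2)) :
  tprod (A + A') B = tprod A B + tprod A' B.
Proof.
elim: m1 A A' => [|m1 IH] A A' /=; first by rewrite addr0.
by rewrite !linearD /= IH -!trowbE linearD /= add_col_mx.
Qed.

Lemma tprodZ m1 n1 m2 n2 a b (A : 'M[K]_(m1, n1)) (B : 'M[K]_(m2, n2)) :
  tprod (a *: A) (b *: B) = (a * b) *: tprod A B.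
Proof.
elim: m1 A => [|m1 IH] A /=; first by rewrite scaler0.
rewrite !linearZ /= IH -!trowbE linearZ /= !trowbE linearZ /= scalerA.
by rewrite -scale_col_mx.
Qed.

Lemma tprod0l m1 n1 m2 n2 (B : 'M[K]_(m2, n2)) :
  tprod (0 : 'M[K]_(m1, n1)) B = 0.
Proof. by rewrite -(scale0r 0) -[B]scale1r tprodZ mul0r scale0r. Qed.

Lemma tprod_scalar (a b : K) : tprod (a%:M : 'M_1) (b%:M : 'M_1) = (a * b)%:M.
Proof. by rewrite -[a%:M]scalemx1 -[b%:M]scalemx1 tprodZ tprod1 scalemx1. Qed.

Lemma tprod_cV_entry m n (u : 'cV[K]_m) (v : 'cV[K]_n) i j :
  (tprod (delta_mx 0 i : 'rV_m) (delta_mx 0 j : 'rV_n) *m tprod u v) 0 0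
    = u i 0 * v j 0.
Proof.
rewrite -tprodE -!rowE [row i u]mx11_scalar [row j v]mx11_scalar.
by rewrite tprod_scalar !mxE eqxx mulr1n.
Qed.

End TensorProduct.

(** Each i excludes at most one c. *)
Lemma finField_avoid (F : finFieldType) (S : fieldType)
    (iota : {rmorphism F -> S}) (I : finType) (x y : I -> S) :
  (#|I| < #|F|)%N -> exists c, forall i, y i != 0 -> x i + iota c * y i != 0.
Proof.
move=> ltIF.
pose bad c i := (y i != 0) && (x i + iota c * y i == 0).
have [c /existsPn good|all_bad] := pickP (fun c => ~~ [exists i, bad c i]).
  by exists c => i yi; have := good i; rewrite /bad yi.
have bad_ex c : exists i, bad c i.
  by apply/existsP; have := all_bad c => /negbFE.
pose f c := xchoose (bad_ex c).
suff /leq_card : injective f by rewrite leqNgt ltIF.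
move=> c c' fcc'; have /andP[y0 /eqP xc] := xchooseP (bad_ex c).
have /andP[_ /eqP] := xchooseP (bad_ex c'); rewrite -/(f c') -fcc' -[RHS]xc.
by move=> /addrI/(mulIf y0)/fmorph_inj.
Qed.

Lemma coef_mul_top (R : comNzRingType) (f g : {poly R}) i j :
  (size f <= i.+1)%N -> (size g <= j.+1)%N -> (f * g)`_(i + j) = f`_i * g`_j.
Proof.
move=> szf szg; rewrite coefM.
rewrite (bigD1 (Ordinal (leq_addr j i : (i < (i + j).+1)%N))) //= addKn.
rewrite big1 ?addr0 // => l; rewrite -val_eqE /= neq_ltn => /orP[] lti.
  by rewrite [g`_ _]nth_default ?mulr0 // (leq_trans szg) //; lia.
by rewrite [f`_ _]nth_default ?mul0r // (leq_trans szf).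
Qed.

Section CyclicFunctional.

Variables (F : finFieldType) (S : fieldType) (iota : {rmorphism F -> S}).
Variables (p s k n m : nat) (alpha : S).
Hypotheses (cardF : #|F| = p) (chS : p \in [pchar S]) (odd_p : odd p).
Hypotheses (s_gt0 : (0 < s)%N) (sk : (s + k < p)%N).
Hypotheses (nE : n = (s + k * p.+1)%N) (mE : m = (n + p.-1)%N).
Hypotheses (alpha0 : alpha != 0) (alphaV : alpha ^+ p = - alpha).

Let p_gt1 : (1 < p)%N := prime_gt1 (pcharf_prime chS).

Lemma iota_exp_card a : iota a ^+ p = iota a.
Proof. by rewrite -rmorphXn -cardF expf_card. Qed.

Definition mirabolic_mx (a b : F) : 'M[F]_2 :=
  \matrix_(i, j) (if j == 0 then (i == 0)%:R else if i == 0 then a else b).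

Definition tens_ev N1 N2 A :=
  tprod (ev_mx iota alpha N1 A) (ev_mx iota alpha N2 A).

Local Notation Z a b := ((iota a + iota b * alpha)%:P
  + (iota a - iota b * alpha)%:P * 'X : {poly S}).

Lemma ev_mirabolic_mx a b N i : ev iota alpha (mirabolic_mx a b) 'X_[mon N i]
  = (1 + 'X) ^+ i * Z a b ^+ (N - i).
Proof.
rewrite ev_mon /line_form /point !mxE /= rmorph0 rmorph1 !mul0r !addr0 mul1r.
by rewrite mulrN.
Qed.

Lemma mirabolic_frobenius a b :
  (iota a + iota b * alpha) ^+ p = iota a - iota b * alpha /\
  (iota a - iota b * alpha) ^+ p = iota a + iota b * alpha.
Proof.
have H x y : x ^+ p = y -> (iota a + iota b * x) ^+ p = iota a + iota b * y.
  move=> xy; rewrite -(pFrobenius_autE chS) rmorphD rmorphM /=.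
  by rewrite !pFrobenius_autE !iota_exp_card xy.
split; first by rewrite -mulrN; apply: H.
by rewrite -mulrN; apply: H; apply: alphaNV.
Qed.

(* The coefficients of beta^0 and beta^(p-1) on V_(p-1), that is, evaluation at
   zeta and at zeta'. *)
Let low : 'cV[S]_p.-1.+1 := delta_mx ord0 0.
Let top : 'cV[S]_p.-1.+1 := delta_mx ord_max 0.

Lemma steinberg_top a b j :
  (ev_mx iota alpha p.-1 (mirabolic_mx a b) *m top) j 0
    = (iota a - iota b * alpha) ^+ (p.-1 - j).
Proof.
rewrite -colE !mxE ev_mirabolic_mx /=.
have lej : (j <= p.-1)%N by rewrite -ltnS.
move: (nat_of_ord j) lej => {}j lej.
have := @coef_mul_top _ ((1 + 'X) ^+ j) (Z a b ^+ (p.-1 - j)) j (p.-1 - j).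
rewrite subnKC // => ->; rewrite ?size_Z_exp //; last first.
  by have := size_Z_exp (1 : S) 1 j; rewrite !polyC1 mul1r.
have := coef_linear_exp (1 : S) 1 j j; rewrite !polyC1 mul1r => ->.
by rewrite coef_linear_exp !subnn !expr0 !expr1n !binn !mul1r.
Qed.

Lemma steinberg_low a b j :
  (ev_mx iota alpha p.-1 (mirabolic_mx a b) *m low) j 0
    = (iota a + iota b * alpha) ^+ (p.-1 - j).
Proof.
rewrite -colE !mxE ev_mirabolic_mx coef0M.
have := coef_linear_exp (1 : S) 1 j 0; rewrite !polyC1 mul1r => ->.
by rewrite coef_linear_exp !bin0 !subn0 !expr0 !expr1n !mul1r mulr1.
Qed.

(* Both tensors have weight n modulo p^2 - 1: the weights of the factors are
   m and p (p - 1) for lamA, n + p (p - 1) and p - 1 for lamB. *)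
Let lamA := tprod (hw_functional S p s k m) top.
Let lamB := tprod (top_functional S p m) low.

Let entry i j (M : 'M[S]_(m.+1 * p.-1.+1, 1 * 1)) : S :=
  (tprod (delta_mx 0 i : 'rV_m.+1) (delta_mx 0 j : 'rV_p.-1.+1) *m M) 0 0.

Let entry_tens A u v i j : entry i j (tens_ev m p.-1 A *m tprod u v)
  = (ev_mx iota alpha m A *m u) i 0 * (ev_mx iota alpha p.-1 A *m v) j 0.
Proof. by rewrite /entry -tprodE tprod_cV_entry. Qed.

Let ev_mx_mirabolic N a b (u : 'cV_N.+1) i :
  (ev_mx iota alpha N (mirabolic_mx a b) *m u) i 0
    = \sum_(j < N.+1) ((1 + 'X) ^+ i * Z a b ^+ (N - i))`_j * u j 0.
Proof. by rewrite mxE; apply: eq_bigr => j _; rewrite mxE ev_mirabolic_mx. Qed.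

Lemma degree_hw :
  (1 < s)%N -> (p * k.+1 < m.+1)%N /\ (m - p * k.+1 = s + k - 1)%N.
Proof.
move=> s2; have -> : m = (p * k.+1 + (s + k - 1))%N by rewrite mE nE; lia.
by rewrite ltnS leq_addr addKn.
Qed.

Lemma degree_top : (s + k < m.+1)%N /\ (m - (s + k) = k * p + p.-1)%N.
Proof.
have -> : m = (s + k + (k * p + p.-1))%N by rewrite mE nE mulnS; lia.
by rewrite ltnS leq_addr addKn.
Qed.

Let entA a b (j : 'I_p.-1.+1) : (1 < s)%N ->
  entry (inord (p * k.+1)) j (tens_ev m p.-1 (mirabolic_mx a b) *m lamA)
   = s.-1%:R * (s + k - 1)`!%:R *
     ((iota a + iota b * alpha) ^+ (s - 2)
      * (iota a - iota b * alpha) ^+ (p.-1 - j)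
      * (iota a + iota b * alpha - (iota a - iota b * alpha)) ^+ k.+1).
Proof.
move=> s2; have [lt Em] := degree_hw s2.
rewrite entry_tens steinberg_top ev_mx_mirabolic inordK // Em.
rewrite (hw_functional_value chS s_gt0 sk nE mE).
by ring.
Qed.

Let entAB a b (j : 'I_p.-1.+1) : (1 < s)%N ->
  entry (inord (p * k.+1)) j (tens_ev m p.-1 (mirabolic_mx a b) *m lamB) = 0.
Proof.
move=> s2; have [lt Em] := degree_hw s2.
rewrite entry_tens ev_mx_mirabolic inordK // Em.
by rewrite (top_functional_value0 chS s_gt0 sk nE mE) mul0r.
Qed.

Let entB a b (j : 'I_p.-1.+1) :
  entry (inord (s + k)) j (tens_ev m p.-1 (mirabolic_mx a b) *m lamB)
   = (iota a + iota b * - alpha) ^+ (p.-1 - s)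
      * (iota a - iota b * - alpha) ^+ (p.-1 - j)
      * (iota a + iota b * - alpha - (iota a - iota b * - alpha)) ^+ (s + k).
Proof.
have [lt Em] := degree_top; have [zp z'p] := mirabolic_frobenius a b.
rewrite entry_tens steinberg_low ev_mx_mirabolic inordK // Em.
rewrite (top_functional_value chS s_gt0 sk nE mE zp z'p odd_p) !mulrN opprK.
by ring.
Qed.

Let entry_sum i j e M :
  entry i j (\sum_(a : F) \sum_(b : F | b != 0)
    iota b ^+ e *: (tens_ev m p.-1 (mirabolic_mx a b) *m M))
  = \sum_(a : F) \sum_(b : F | b != 0) iota b ^+ e *
      entry i j (tens_ev m p.-1 (mirabolic_mx a b) *m M).
Proof.
rewrite /entry mulmx_sumr summxE; apply: eq_bigr => a _.
rewrite mulmx_sumr summxE; apply: eq_bigr => b _.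
by rewrite -scalemxAr mxE.
Qed.

(** The value at all tensors of the relation (a, b) |-> b^e. *)
Definition mirabolic_moment (lam : 'M[S]_(m.+1 * p.-1.+1, 1 * 1)) e :=
  \sum_(a : F) \sum_(b : F | b != 0)
    iota b ^+ e *: (tens_ev m p.-1 (mirabolic_mx a b) *m lam).

(** The tensors are products of monomials, with first factor
    X^(p (k+1)) Y^(s+k-1) for lamA and X^(s+k) Y^(k p + p - 1) for lamB.  The
    exponent of Y in the second factor is forced by homogeneity: the total
    degree in (a, b) must be divisible by p - 1.  With r the residue of
    - (e + k + 1) modulo p - 1, it lies in the range of [mirabolic_sum_neq0] for
    the first tensor if r < s - 1, and for the second one otherwise. *)
Let mirabolic_moment_cases e : exists i j,
  (entry i j (mirabolic_moment lamA e) != 0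
    /\ entry i j (mirabolic_moment lamB e) = 0)
  \/ entry i j (mirabolic_moment lamB e) != 0.
Proof.
pose r := ((p.-1 - (e + k.+1) %% p.-1) %% p.-1)%N.
have p2 : (0 < p.-1)%N by lia.
have ltr : (r < p.-1)%N by rewrite ltn_mod.
have dvdr : (p.-1 %| e + k.+1 + r)%N.
  rewrite /dvdn /r modnDmr -modnDml subnKC ?modnn //.
  by rewrite ltnW // ltn_mod.
have [s_small|s_large] := ltnP r s.-1.
  have s2 : (1 < s)%N by lia.
  exists (inord (p * k.+1)), (inord (s - 2 - r)).
  have jE : (p.-1 - (inord (s - 2 - r) : 'I_p.-1.+1) = p.-1 - (s - 2) + r)%N.
    by rewrite inordK; lia.
  left; split; rewrite /mirabolic_moment entry_sum.
    under eq_bigr => a _.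
      under eq_bigr do rewrite entA // mulrCA.
      rewrite -mulr_sumr.
      over.
    rewrite -mulr_sumr mulf_neq0 ?mulf_neq0 ?(pchar_fact_neq0 chS) //;
      [|by lia|].
      by rewrite (pchar_natr_neq0 chS) //; lia.
    rewrite jE; apply: (mirabolic_sum_neq0 _ cardF chS) => //; first by lia.
      by lia.
    rewrite (_ : e + _ + _ + _ = e + k.+1 + r + p.-1)%N; last by lia.
    by rewrite dvdn_addl.
  apply: big1 => a _; apply: big1 => b _.
  by rewrite entAB // mulr0.
exists (inord (s + k)), (inord (p.-1 - s - (r - s.-1))); right.
have jE : (p.-1 - (inord (p.-1 - s - (r - s.-1)) : 'I_p.-1.+1)
    = s + (r - s.-1))%N.
  by rewrite inordK; lia.
rewrite /mirabolic_moment entry_sum.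
under eq_bigr do under eq_bigr do rewrite entB.
rewrite jE; apply: (mirabolic_sum_neq0 _ cardF chS) => //.
- by rewrite oppr_eq0.
- by lia.
- by lia.
rewrite (_ : e + _ + _ + _ = e + k.+1 + r + p.-1)%N; last by lia.
by rewrite dvdn_addl.
Qed.

Lemma cyclic_functional : exists lam : 'M[S]_(m.+1 * p.-1.+1, 1 * 1),
  [/\ forall A, tprod (map_mx iota (D_mx F p n m) *m ev_mx iota alpha m A)
         (ev_mx iota alpha p.-1 A) *m lam = 0,
      forall (T A : 'M[F]_2) tau, point iota alpha T 0 = tau ->
        point iota alpha T 1 = tau * alpha -> tau ^+ (p ^ 2).-1 = 1 ->
        tens_ev m p.-1 (T *m A) *m lam = tau ^+ n *: (tens_ev m p.-1 A *m lam)
    & forall e, (e < p.-1)%N -> mirabolic_moment lam e != 0].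
Proof.
have [ij ijP] : {ij : 'I_p.-1 -> 'I_m.+1 * 'I_p.-1.+1 | forall e : 'I_p.-1,
  let: (i, j) := ij e in
  (entry i j (mirabolic_moment lamA e) != 0
    /\ entry i j (mirabolic_moment lamB e) = 0)
  \/ entry i j (mirabolic_moment lamB e) != 0}.
  pose P (e : 'I_p.-1) ij :=
    (entry ij.1 ij.2 (mirabolic_moment lamA e) != 0)
      && (entry ij.1 ij.2 (mirabolic_moment lamB e) == 0)
    || (entry ij.1 ij.2 (mirabolic_moment lamB e) != 0).
  have P_ex e : exists ij, P e ij.
    have [i [j Pij]] := mirabolic_moment_cases e; exists (i, j); rewrite /P /=.
    by case: Pij => [[-> ->]|->]; rewrite ?eqxx ?orbT.
  exists (fun e => xchoose (P_ex e)) => e; have := xchooseP (P_ex e).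
  case: (xchoose _) => i j /orP[/andP[xA /eqP xB]|xB]; [left|right] => //.
pose x e := entry (ij e).1 (ij e).2 (mirabolic_moment lamA e).
pose y e := entry (ij e).1 (ij e).2 (mirabolic_moment lamB e).
(* There are p - 1 conditions on the p possible values of c. *)
have [|c xy] := @finField_avoid _ _ iota _ x y.
  by rewrite card_ord cardF; lia.
exists (lamA + iota c *: lamB); split=> [A|T A tau T0 T1 tau1|e lte].
- rewrite mulmxDr -scalemxAr /lamA /lamB -!tprodE.
  rewrite (D_mx_ev chS iota_exp_card alphaV odd_p _ mE); last first.
    exact: (hw_functional_D chS s_gt0 sk nE mE).
  rewrite (D_mx_ev chS iota_exp_card alphaV odd_p _ mE); last first.
    by move=> f _; exact: (top_functional_D chS s_gt0 sk nE mE).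
  by rewrite !tprod0l scaler0 addr0.
- have tauX a b : a = b %[mod (p ^ 2).-1] -> tau ^+ a = tau ^+ b.
    move=> ab; rewrite (divn_eq a (p ^ 2).-1) (divn_eq b (p ^ 2).-1) ab !exprD.
    by rewrite ![(_ * (p ^ 2).-1)%N]mulnC !exprM tau1 !expr1n.
  have evT N (u : 'cV[S]_N.+1) w :=
    ev_mx_torus chS iota_exp_card alphaV odd_p T0 T1 A (u := u) (w := w).
  have p2E : ((p ^ 2).-1 = p.-1 * p.+1)%N.
    by case: (p) p_gt1 => // q _; rewrite expnS expn1 /=; lia.
  have tens_torus N1 N2 (u : 'cV[S]_N1.+1) (v : 'cV[S]_N2.+1) a b d :
      (forall j, u j 0 != 0 -> tau ^+ (N1 + p.-1 * j) = tau ^+ a) ->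
      (forall j, v j 0 != 0 -> tau ^+ (N2 + p.-1 * j) = tau ^+ b) ->
      (a + b = d %[mod (p ^ 2).-1])%N ->
    tens_ev N1 N2 (T *m A) *m tprod u v
      = tau ^+ d *: (tens_ev N1 N2 A *m tprod u v).
    move=> ua vb abc; rewrite -!tprodE (evT _ _ _ ua) (evT _ _ _ vb).
    by rewrite tprodZ -exprD (tauX _ _ abc).
  rewrite !mulmxDr -!scalemxAr scalerDr; congr (_ + _).
    apply: (tens_torus _ _ _ _ m (p.-1 * p)%N) => [j|j|].
    - rewrite mxE; case: ifP => [/dvdnP[l ->]|]; rewrite ?eqxx // => _.
      apply: tauX; rewrite (_ : p.-1 * _ = l * (p ^ 2).-1)%N ?p2E; last by lia.
      by rewrite addnC modnMDl.
    - rewrite mxE eqxx andbT; case: (eqVneq j ord_max) => [-> _|];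
        last by rewrite eqxx.
      by rewrite -mulnS prednK // ltnW.
    rewrite mE (_ : n + _ + _ = 1 * (p ^ 2).-1 + n)%N ?modnMDl // p2E.
    by case: (p) p_gt1 => // q _ /=; lia.
  rewrite [RHS]scalerA mulrC -scalerA; congr (_ *: _).
  apply: (tens_torus _ _ _ _ (n + p.-1 * p)%N p.-1) => [j|j|].
  - rewrite mxE; case: (eqVneq (j : nat) p.-1) => [-> _|];
      last by rewrite eqxx.
    by congr (_ ^+ _); rewrite mE; case: (p) p_gt1 => // q _ /=; lia.
  - rewrite mxE eqxx andbT; case: (eqVneq j ord0) => [-> _|];
      last by rewrite eqxx.
    by rewrite muln0 addn0.
  rewrite (_ : n + _ + _ = 1 * (p ^ 2).-1 + n)%N ?modnMDl // p2E.
  by case: (p) p_gt1 => // q _ /=; lia.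
- have momD M N : mirabolic_moment (M + iota c *: N) e
      = mirabolic_moment M e + iota c *: mirabolic_moment N e.
    rewrite /mirabolic_moment scaler_sumr -big_split; apply: eq_bigr => a _ /=.
    rewrite scaler_sumr -big_split; apply: eq_bigr => b _ /=.
    by rewrite mulmxDr scalerDr -scalemxAr !scalerA mulrC.
  have entD i j M N :
      entry i j (M + iota c *: N) = entry i j M + iota c * entry i j N.
    by rewrite /entry mulmxDr -scalemxAr !mxE.
  rewrite momD; set e' := Ordinal lte; have := ijP e'; have := xy e'.
  rewrite /x /y; case: (ij e') => i j /= xye xyP.
  have : entry i j (mirabolic_moment lamA e
      + iota c *: mirabolic_moment lamB e) != 0.
    rewrite entD; case: xyP => [[xA ->]|/xye //].
    by rewrite mulr0 addr0.
  by apply: contraNneq => ->; rewrite /entry mulmx0 mxE.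
Qed.

End CyclicFunctional.

(** * From the functional to the isomorphism *)

Section MapTensor.

Variables (K K' : fieldType) (f : {rmorphism K -> K'}).

Lemma map_tprod m1 n1 m2 n2 (A : 'M[K]_(m1, n1)) (B : 'M[K]_(m2, n2)) :
  map_mx f (tprod A B) = tprod (map_mx f A) (map_mx f B).
Proof.
have map_trow n (u : 'rV[K]_n) :
    map_mx f (trow u B) = trow (map_mx f u) (map_mx f B).
  elim: n u => [|n IH] u /=; first by rewrite map_mx0.
  by rewrite map_row_mx map_mxZ IH map_rsubmx -map_lsubmx [in RHS]mxE.
elim: m1 A => [|m1 IH] A /=; first by rewrite map_mx0.
by rewrite map_col_mx map_trow IH map_usubmx map_dsubmx.
Qed.

End MapTensor.

Section InducedIsomorphism.

Variables (F : finFieldType) (S : fieldType) (iota : {rmorphism F -> S}).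
Variables (p s k n m : nat) (alpha : S).
Hypotheses (cardF : #|F| = p) (chS : p \in [pchar S]) (odd_p : odd p).
Hypotheses (s_gt0 : (0 < s)%N) (sk : (s + k < p)%N).
Hypotheses (nE : n = (s + k * p.+1)%N) (mE : m = (n + p.-1)%N).
Hypotheses (alpha0 : alpha != 0) (alphaV : alpha ^+ p = - alpha).

Variables (gT : finGroupType) (M : gT -> 'M[F]_2).
Local Notation G := [set: gT]%G.
Local Notation ix := (gring_index G).
Hypothesis MM : forall g h, M (g * h)%g = M g *m M h.

Variables (rV : mx_representation F G m.+1).
Variables (rSt : mx_representation F G p.-1.+1).
Hypotheses (rVE : forall g, rV g = sym_mx m (M g^-1%g)).
Hypotheses (rStE : forall g, rSt g = sym_mx p.-1 (M g^-1%g)).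

Variables (U : 'M[F]_m.+1) (Umod : mxmodule rV U).
Hypothesis UE : (U :=: D_mx F p n m)%MS.
Hypothesis D_free : row_free (D_mx F p n m).

Variables (T : {set gT}) (chi : gT -> S).
Hypothesis T_torus : forall t, t \in T -> exists2 tau : S,
  [/\ point iota alpha (M t) 0 = tau, point iota alpha (M t) 1 = tau * alpha
    & tau ^+ (p ^ 2).-1 = 1] & chi t = tau ^+ n.

Variable mir : F * F -> gT.
Hypothesis M_mir : forall a b, b != 0 -> M (mir (a, b)) = mirabolic_mx a b.
Hypothesis mir_factor : forall g, exists2 t, t \in T &
  exists ab : F * F, ab.2 != 0 /\ g = (t * mir ab)%g.

Let p_gt1 : (1 < p)%N := prime_gt1 (pcharf_prime chS).
Let P := [set ab : F * F | ab.2 != 0].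

Let card_P : #|P| = (p.-1 * p.-1.+1)%N.
Proof.
have -> : P = setX [set: F] [set~ 0].
  by apply/setP=> [[a b]]; rewrite !inE.
rewrite cardsX cardsT cardsC1 cardF mulnC prednK //; exact: ltnW.
Qed.

Lemma dim_sym_mod_D : \rank (cokermx U) = p.-1.
Proof.
by rewrite mxrank_coker UE (eqP D_free) mE; lia.
Qed.

Definition mir_restr_mx : 'M[S]_(gcard G, #|P|) :=
  \matrix_(x, i) (x == ix (mir (enum_val i)))%:R.

Lemma mul_mir_restr_mx r (f : 'M_(r, gcard G)) j i :
  (f *m mir_restr_mx) j i = f j (ix (mir (enum_val i))).
Proof.
rewrite mxE (bigD1 (ix (mir (enum_val i)))) //= mxE eqxx mulr1.
by rewrite big1 ?addr0 // => x; rewrite mxE => /negbTE->; rewrite mulr0.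
Qed.

(** Every g is t h with h mirabolic, so f g = chi t * f h. *)
Lemma rank_ind_le : (\rank (ind_mx T chi) <= #|P|)%N.
Proof.
suff /mxrank_injP <- : (ind_mx T chi :&: kermx mir_restr_mx)%MS == 0.
  exact: rank_leq_col.
rewrite -submx0; apply/rV_subP => f; rewrite sub_capmx => /andP[].
move=> /ind_mxP fT /sub_kermxP f0; rewrite submx0; apply/eqP/rowP => j.
rewrite mxE -[j](gring_valK (G := G)).
have [t Tt [ab [b0 ->]]] := mir_factor (enum_val j).
rewrite fT //; have Pab : ab \in P by rewrite inE.
have /rowP/(_ (enum_rank_in Pab ab)) := f0.
by rewrite mul_mir_restr_mx enum_rankK_in // !mxE => ->; rewrite mulr0.
Qed.

(** The matrix is the map v |-> (g |-> lam (g v)) of Frobenius reciprocity.  It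
    has full rank because a relation between its columns at the mirabolic
    elements would give one excluded by [cyclic_functional]. *)
Lemma tensor_rsim_ind :
  mx_rsim (map_repr iota (prod_repr (factmod_repr Umod) rSt))
          (ind_repr T chi).
Proof.
have [lam [lamD lamT lam_test]] :=
  cyclic_functional iota cardF chS odd_p s_gt0 sk nE mE alpha0 alphaV.
pose C : 'M[S]_(_, m.+1) := map_mx iota (val_factmod (U := U) 1%:M).
pose E A := ev_mx iota alpha m A; pose E' A := ev_mx iota alpha p.-1 A.
(* lam only sees vectors of V_m modulo the image of D. *)
have mod_D r (X : 'M[F]_(r, m.+1)) A :
    tprod (map_mx iota X *m E A) (E' A) *m lam
      = tprod (map_mx iota (val_factmod (in_factmod U X)) *m E A) (E' A) *m lam.
  have /submxP[W WE] : (val_submod (in_submod U X) <= D_mx F p n m)%MS.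
    by rewrite -UE val_submodP.
  rewrite -{1}(add_sub_fact_mod U X) WE map_mxD mulmxDl tprodDl mulmxDl.
  rewrite map_mxM -mulmxA -[X in tprod _ X]mul1mx tprodE -mulmxA lamD.
  by rewrite mulmx0 add0r.
(* The column at g: the functional v |-> lam (g v) on the quotient. *)
pose TC g := tprod (C *m E (M g)) (E' (M g)) *m lam.
have TCE g : TC g = tprod C 1%:M *m (tens_ev iota alpha m p.-1 (M g) *m lam).
  by rewrite /TC /tens_ev mulmxA -tprodE mul1mx.
pose B0 : 'M[S]_(_, gcard G) := \matrix_(i, x) TC (enum_val x) i 0.
have B0E i g : B0 i (ix g) = TC g i 0 by rewrite mxE gring_indexK ?inE.
have B0_ind : (B0 <= ind_mx T chi)%MS.
  apply/row_subP => i; apply/ind_mxP => t x Tt.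
  have rowB g : row i B0 0 (ix g) = TC g i 0 by rewrite mxE B0E.
  rewrite !rowB.
  have [tau [T0 T1 tau1] ->] := T_torus Tt.
  by rewrite !TCE MM (lamT _ _ tau) // -scalemxAr mxE.
have B0_rho g : map_repr iota (prod_repr (factmod_repr Umod) rSt) g *m B0
    = B0 *m regular_repr S G g.
  apply/matrixP => i j; rewrite -[j](gring_valK (G := G)).
  set x := enum_val j.
  have -> : (B0 *m regular_repr S G g) i (ix x) = TC (x * g^-1)%g i 0.
    have := regular_actE (row i B0) g x; rewrite -row_mul mxE => ->.
    by rewrite mxE B0E.
  have -> : map_repr iota (prod_repr (factmod_repr Umod) rSt) g
      = tprod (map_mx iota (factmod_repr Umod g)) (map_mx iota (rSt g)).
    by rewrite map_reprE /= map_tprod.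
  rewrite mxE; under eq_bigr do rewrite B0E.
  transitivity ((tprod (map_mx iota (factmod_repr Umod g)) (map_mx iota (rSt g))
                  *m TC x) i 0); first by rewrite mxE.
  rewrite /TC mulmxA -tprodE /C mulmxA -map_mxM.
  have -> : factmod_repr Umod g *m val_factmod (U := U) 1%:M
      = val_factmod (in_factmod U (val_factmod (U := U) 1%:M *m rV g)).
    by rewrite -val_factmodE.
  rewrite -[map_mx _ (val_factmod _) *m _]mul1mx tprodE -mulmxA -mod_D.
  rewrite mulmxA -tprodE mul1mx map_mxM -mulmxA rVE rStE /E /E' !sym_mx_ev.
  by rewrite -!MM.
have lam_mod A : tens_ev iota alpha m p.-1 A *m lam
    = tprod (map_mx iota (in_factmod U 1%:M)) 1%:M
        *m (tprod C 1%:M *m (tens_ev iota alpha m p.-1 A *m lam)).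
  rewrite /tens_ev !mulmxA -!tprodE !mul1mx -/(E A) -/(E' A) /C -map_mxM.
  by rewrite -val_factmodE -mod_D map_mx1 mul1mx.
pose v a b := tens_ev iota alpha m p.-1 (mirabolic_mx a b) *m lam.
pose V := 'M[S]_(m.+1 * p.-1.+1, 1 * 1).
have v_mul (a' b' : F) : exists f : {linear V -> V},
    forall a b, v (a' + a * b') (b * b') = f (v a b).
  pose H := mirabolic_mx a' b'.
  exists (mulmx (tprod (map_mx iota (sym_mx m H))
                       (map_mx iota (sym_mx p.-1 H)))).
  move=> a b; rewrite /v /= mulmxA /tens_ev -tprodE !sym_mx_ev.
  rewrite (_ : mirabolic_mx (a' + a * b') (b * b')
    = mirabolic_mx a b *m H) //.
  apply/matrixP => i j; rewrite !mxE !big_ord_recl big_ord0 !mxE /=.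
  by case: i => [[|[|i]] //= lti]; case: j => [[|[|j]] //= ltj]; ring.
(* A relation w between the mirabolic columns becomes a function of (a, b). *)
have B0_free : row_free (B0 *m mir_restr_mx)^T.
  apply: inj_row_free => w w0; apply/rowP => i0; rewrite mxE.
  pose w' a b :=
    if [pick i : 'I_#|P| | enum_val i == (a, b)] is Some i then w 0 i else 0.
  have w'E i : w' (enum_val i).1 (enum_val i).2 = w 0 i.
    rewrite /w' -surjective_pairing.
    case: pickP => [i' /eqP/enum_val_inj-> //|].
    by move/(_ i); rewrite eqxx.
  have v_rel : \sum_(a : F) \sum_(b : F | b != 0) w' a b *: v a b = 0.
    rewrite pair_big_dep /= (eq_bigl (mem P)); last first.
      by move=> [a b]; rewrite !inE.
    rewrite big_enum_val /=.
    under eq_bigr => i _.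
      rewrite w'E /v (lam_mod _) -M_mir; last first.
        by have := enum_valP i; rewrite inE.
      rewrite -surjective_pairing -TCE scalemxAr.
      over.
    rewrite -mulmx_sumr [X in _ *m X](_ : _ = 0) ?mulmx0 //.
    apply/colP => j.
    transitivity ((w *m (B0 *m mir_restr_mx)^T) 0 j); last by rewrite w0 !mxE.
    rewrite summxE [RHS]mxE; apply: eq_bigr => i _.
    by rewrite [LHS]mxE [X in _ = _ * X]mxE mul_mir_restr_mx B0E.
  apply/eqP; apply: contraT => wi0.
  have [|||e lte] := affine_orbit_relation iota cardF chS _ _ v_rel.
  - move=> t; have [f fE] := v_mul t 1; exists f => a b _.
    by rewrite -fE mulr1 mulr1 addrC.
  - move=> c _; have [f fE] := v_mul 0 c; exists f => a b _.
    by rewrite -fE add0r.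
  - exists (enum_val i0).1, (enum_val i0).2; rewrite w'E wi0; split=> //.
    by have := enum_valP i0; rewrite inE.
  move/eqP; rewrite -[X in X == _]/(mirabolic_moment iota alpha lam e).
  by rewrite (negbTE (lam_test e lte)).
have q_eq := dim_sym_mod_D.
have rB0 : \rank B0 = #|P|.
  apply/eqP; rewrite eqn_leq (leq_trans (mxrankS B0_ind) rank_ind_le) /=.
  rewrite -(eqP B0_free) mxrank_tr; exact: mxrankM_maxl.
have r_ind : \rank (ind_mx T chi) = #|P|.
  by apply/eqP; rewrite eqn_leq rank_ind_le -rB0 mxrankS.
apply: (MxReprSim (B := in_submod (ind_mx T chi) B0)).
- by rewrite r_ind card_P q_eq.
- by rewrite /row_free mxrank_in_submod // rB0 card_P q_eq.
by move=> g _; rewrite -in_submodJ // -B0_rho in_submodE mulmxA -in_submodE.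
Qed.

End InducedIsomorphism.

(** * The nonsplit torus and its mirabolic complement *)

Section ConcreteTorus.

Variables (p : nat) (pr_p : prime p) (L : fieldExtType 'F_p).
Variables (alpha : L) (d : 'F_p).
Hypotheses (alphaNF : alpha \notin 1%VS) (alpha2 : alpha ^+ 2 = d%:A).

Lemma in_alg_exp_p (a : 'F_p) : in_alg L a ^+ p = in_alg L a.
Proof.
by rewrite -(rmorphXn (in_alg L)) /= -[X in _ ^+ X](card_Fp pr_p) expf_card.
Qed.

Lemma frobenius_fixed (x : L) : x ^+ p = x -> x \in 1%VS.
Proof.
move=> xp; have := finField_genPoly 'F_p; rewrite card_Fp // => /(congr1
  (fun q : {poly 'F_p} => (map_poly (in_alg L) q).[x])).
rewrite rmorphB rmorphXn /= map_polyX hornerD hornerN hornerXn hornerX xp subrr.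
rewrite rmorph_prod horner_prod => /esym/eqP/prodf_eq0[a _].
rewrite rmorphB /= map_polyX map_polyC hornerXsubC subr_eq0 => /eqP->.
by rewrite memvZ ?mem1v.
Qed.

(** alpha^p is a square root of d other than alpha. *)
Lemma alpha_exp_p : alpha ^+ p = - alpha.
Proof.
have /eqP : (alpha ^+ p) ^+ 2 = alpha ^+ 2.
  by rewrite -exprM mulnC exprM alpha2 in_alg_exp_p.
rewrite eqf_sqr => /orP[/eqP/frobenius_fixed|/eqP //].
by rewrite (negbTE alphaNF).
Qed.

Lemma omega2_neq0 (g : {'GL_2['F_p]}) : omega2 alpha g != 0.
Proof.
apply/eqP => /(torus_coord0 alphaNF)[g0 g1].
have := GL_det g; rewrite (expand_det_col _ 0) !big_ord_recl big_ord0.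
rewrite (_ : lift ord0 ord0 = 1); last exact: val_inj.
by rewrite g0 g1 !mul0r !addr0 eqxx.
Qed.

Lemma mirabolic_unit (a b : 'F_p) : b != 0 ->
  mirabolic_mx a b \in unitmx.
Proof.
move=> b0; rewrite unitmxE unitfE (expand_det_col _ 0) !big_ord_recl big_ord0.
by rewrite /cofactor !det_mx11 !mxE /= mul0r !addr0 !mul1r.
Qed.

Lemma point_torus1 (t : {'GL_2['F_p]}) : t \in torus d ->
  point (in_alg L) alpha (GLval t) 1 = omega2 alpha t * alpha.
Proof.
move=> /torus_mxP ->; rewrite /omega2 /point !mxE /= mulrDl -mulrA -expr2.
rewrite alpha2.
by rewrite [(_ * d)%:A](rmorphM (in_alg L)) addrC.
Qed.

(** Defined by the first column, omega2 makes sense on all of GL_2; it is the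
    first coordinate of (1, alpha) g. *)
Lemma omega2_torusM (t h : {'GL_2['F_p]}) : t \in torus d ->
  omega2 alpha (t * h)%g = omega2 alpha t * omega2 alpha h.
Proof.
move=> Tt; pose point0 := point (in_alg L) alpha.
have E : point0 (GLval (t * h)%g) 0
    = point0 (GLval t) 0 * in_alg L (GLval h 0 0)
      + point0 (GLval t) 1 * in_alg L (GLval h 1 0).
  by rewrite GL_MxE; apply: point_mul.
rewrite -[LHS]/(point0 _ 0) E /point0 point_torus1 //.
by rewrite /omega2 /point /=; ring.
Qed.

Lemma omega2_order (t : {'GL_2['F_p]}) : odd p ->
  omega2 alpha t ^+ (p ^ 2).-1 = 1.
Proof.
move=> odd_p; have chL : p \in [pchar L] by rewrite pchar_lalg pchar_Fp.
have H := point_exp_p chL in_alg_exp_p (GLval t) 0.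
apply: (mulfI (omega2_neq0 t)); rewrite mulr1 -exprS.
rewrite prednK ?expn_gt0 ?prime_gt0 // expnS expn1 exprM.
rewrite -[omega2 alpha t]/(point (in_alg L) alpha (GLval t) 0).
by rewrite (H _ _ alpha_exp_p) (H _ _ (alphaNV alpha_exp_p odd_p)).
Qed.

Definition mirabolic_GL (ab : 'F_p * 'F_p) : {'GL_2['F_p]} :=
  if idP is ReflectT uH
  then FinRing.Unit (uH : mirabolic_mx ab.1 ab.2 \is a GRing.unit) else 1%g.

Lemma mirabolic_GLE (a b : 'F_p) :
  b != 0 -> GLval (mirabolic_GL (a, b)) = mirabolic_mx a b.
Proof.
move=> /(mirabolic_unit a) uH; rewrite /mirabolic_GL.
by case: {-}_ / idP => // nuH; case: nuH.
Qed.

(** Choose t with omega2 t = omega2 g; then omega2 (t^-1 g) = 1, so the first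
    column of t^-1 g is that of a mirabolic matrix. *)
Lemma torus_mirabolic_factor (dimL : \dim {:L} = 2%N) (g : {'GL_2['F_p]}) :
  exists2 t, t \in torus d &
    exists ab, ab.2 != 0 /\ g = (t * mirabolic_GL ab)%g.
Proof.
have [t Tt tg] := omega2_surj alphaNF alpha2 dimL (omega2_neq0 g).
exists t => //; pose h := (t^-1 * g)%g.
have gE : g = (t * h)%g by rewrite mulKVg.
clearbody h.
have [h00 h10] : GLval h 0 0 = 1 /\ GLval h 1 0 = 0.
  have h1 : omega2 alpha h = 1.
    apply: (mulfI (omega2_neq0 t)).
    by rewrite -omega2_torusM // -gE mulr1.
  have /(torus_coord0 alphaNF)[/eqP h00 h10] :
      (GLval h 0 0 - 1)%:A + (GLval h 1 0)%:A * alpha = 0 :> L.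
    by rewrite scalerBl scale1r addrAC -/(omega2 alpha h) h1 subrr.
  by split=> //; apply/eqP; rewrite -subr_eq0.
have h11 : GLval h 1 1 != 0.
  have := GL_det h; rewrite (expand_det_col _ 0) !big_ord_recl big_ord0.
  rewrite (_ : lift ord0 ord0 = 1); last exact: val_inj.
  rewrite h00 h10 /cofactor det_mx11 !mxE mul0r !addr0 !mul1r.
  by rewrite (_ : lift 0 0 = 1); last exact: val_inj.
exists (GLval h 0 1, GLval h 1 1); split => //.
rewrite {1}gE; congr (_ * _)%g; apply: val_inj.
rewrite -[LHS]/(GLval h) -[RHS]/(GLval _) mirabolic_GLE //.
have I2 (l : 'I_2) : l = 0 \/ l = 1.
  by case: l => [[|[|l]] //= ltl]; [left | right]; apply: val_inj.
apply/matrixP => i j; rewrite [RHS]mxE.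
by case: (I2 i) => ->; case: (I2 j) => ->; rewrite ?h00 ?h10.
Qed.

End ConcreteTorus.

Unset Implicit Arguments.

Theorem corollary4p3 (p : nat) (pr_p : prime p) (odd_p : odd p)
    (L : fieldExtType 'F_p) (dimL : \dim {:L} = 2%N)
    (alpha : L) (d : 'F_p)
    (alphaNF : alpha \notin 1%VS) (alpha2 : alpha ^+ 2 = d%:A)
    (k : nat) (r : int)
    (hk : (k <= p - 2)%N) (hr1 : -1 <= r) (hr2 : r <= p%:Z - 3 - k%:Z) :
  mx_rsim
    (map_repr (in_alg L)
       (prod_repr (sym_mod_D pr_p (degreeE k pr_p hr1)) (sym_repr p p.-1)))
    (ind_repr (torus d)
       (fun t => omega2 alpha t ^+ absz (r + 2 + k%:Z * (p%:Z + 1)))).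
Proof.
(* s = r + 2; n mod p is s + k, which is positive and less than p. *)
have [s [s_gt0 sk nE]] : exists s, [/\ (0 < s)%N, (s + k < p)%N
    & absz (r + 2 + k%:Z * (p%:Z + 1)) = (s + k * p.+1)%N].
  by exists (absz (r + 2)); split; nia.
have mE := degreeE k pr_p hr1.
set n := absz (r + 2 + _) in nE mE *; set m := absz (r + _ * _) in mE *.
have chL : p \in [pchar L] by rewrite pchar_lalg pchar_Fp.
have p1 := prime_gt1 pr_p.
have alpha0 : alpha != 0 by apply: contraNneq alphaNF => ->; rewrite mem0v.
have D_free : row_free (D_mx 'F_p p n m).
  apply: D_mx_free => //.
  rewrite {2}nE (_ : s + _ = k * p + (s + k))%N; last by lia.
  rewrite modnMDl modn_small //.
  by rewrite nE; nia.
have GM (g h : {'GL_2['F_p]}) : GLval (g * h)%g = GLval g *m GLval h.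
  by rewrite GL_MxE.
apply: (tensor_rsim_ind (card_Fp pr_p) chL odd_p s_gt0 sk nE mE alpha0
  (alpha_exp_p pr_p alphaNF alpha2) GM _ _ _ _ _ _ (@mirabolic_GLE p)) => //.
- exact: genmxE.
- move=> t Tt; exists (omega2 alpha t) => //; split=> //.
    exact: (point_torus1 alpha2).
  exact: (omega2_order pr_p alphaNF alpha2).
- by move=> g; apply: (torus_mirabolic_factor alphaNF alpha2).
Qed.
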